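(* The calculus $LS_{BBI}+P$ is sound and cut-free complete with respect to the partial commutative monoidal semantics for BBI: for every formula $F$, (i) if $\emptyset;\emptyset\vdash w:F$ is derivable in $LS_{BBI}+P$ (possibly with cut) for some label $w$, then $F$ is valid over all frames $(H,R,\epsilon)$ satisfying identity, commutativity, associativity and partial-determinism; and (ii) if $F$ is valid over all such frames, then $\emptyset;\emptyset\vdash w:F$ is derivable in $LS_{BBI}+P$ without cut for some label variable $w$.
   Context: Formulae: $A ::= p \mid \top\mid\bot\mid\neg A\mid A\vee A\mid A\wedge A\mid A\to A\mid \top^*\mid A*A\mid A\mathrel{-\!\!*}A$, $p\in Var$. Semantics. A frame is $(H,R,\epsilon)$, $H$ nonempty, $R\subseteq H^3$, $\epsilon\in H$. Conditions (for all $h_i\in H$): (identity) $R(h_1,\epsilon,h_2)\iff h_1=h_2$; (commutativity) $R(h_1,h_2,h_3)\iff R(h_2,h_1,h_3)$; (associativity) $R(h_1,h_5,h_4)\wedge R(h_2,h_3,h_5)\Rightarrow\exists h_6\,(R(h_6,h_3,h_4)\wedge R(h_1,h_2,h_6))$; (partial-determinism) $R(h_1,h_2,h_3)\wedge R(h_1,h_2,h_4)\Rightarrow h_3=h_4$. A model adds $\nu:Var\to\mathcal{P}(H)$; forcing: $h\Vdash p$ iff $h\in\nu(p)$; $\top$ always, $\bot$ never; $\neg,\wedge,\vee,\to$ classical; $h\Vdash\top^*$ iff $h=\epsilon$; $h\Vdash A*B$ iff $\exists h_1,h_2$ with $R(h_1,h_2,h)$, $h_1\Vdash A$, $h_2\Vdash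 B$; $h\Vdash A\mathrel{-\!\!*}B$ iff $\forall h_1,h_2$, $R(h,h_1,h_2)$ and $h_1\Vdash A$ imply $h_2\Vdash B$. Valid over a class = forced at every world of every model on a frame in the class. Calculus. Labels: $LVar\cup\{\epsilon\}$. Labelled formula $a:A$; relational atom $(a,b\triangleright c)$; sequent $\mathcal{G};\Gamma\vdash\Delta$ with $\mathcal{G}$ a set of relational atoms and $\Gamma,\Delta$ multisets of labelled formulae; $[y/x]$ ($x$ label variable) uniform replacement; $\neg A:=A\to\bot$, $A\vee B:=\neg A\to B$. $LS_{BBI}$ rules (fresh = label variable not in conclusion): $id$: axiom $\mathcal{G};\Gamma,w:p\vdash w:p,\Delta$; $cut$: $\mathcal{G};\Gamma\vdash x:A,\Delta$ and $\mathcal{G}';\Gamma',x:A\vdash\Delta'\Rightarrow\mathcal{G},\mathcal{G}';\Gamma,\Gamma'\vdash\Delta,\Delta'$; $\bot L$: axiom $\mathcal{G};\Gamma,w:\bot\vdash\Delta$; $\top R$: axiom $\mathcal{G};\Gamma\vdash w:\top,\Delta$; $\top^*R$: axiom $\mathcal{G};\Gamma\vdash\epsilon:\top^*,\Delta$; $\top^*L$: $(\epsilon,w\triangleright\epsilon),\mathcal{G};\Gamma\vdash\Delta\Rightarrow\mathcal{G};\Gamma,w:\top^*\vdash\Delta$; $\wedge L$: $\mathcal{G};\Gamma,w:A,w:B\vdash\Delta\Rightarrow\mathcal{G};\Gamma,w:A\wedge B\vdash\Delta$; $\wedge R$: $\mathcal{G};\Gamma\vdash w:A,\Delta$ and $\mathcal{G};\Gamma\vdash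 w:B,\Delta\Rightarrow\mathcal{G};\Gamma\vdash w:A\wedge B,\Delta$; $\to L$: $\mathcal{G};\Gamma\vdash w:A,\Delta$ and $\mathcal{G};\Gamma,w:B\vdash\Delta\Rightarrow\mathcal{G};\Gamma,w:A\to B\vdash\Delta$; $\to R$: $\mathcal{G};\Gamma,w:A\vdash w:B,\Delta\Rightarrow\mathcal{G};\Gamma\vdash w:A\to B,\Delta$; $*L$: $(x,y\triangleright z),\mathcal{G};\Gamma,x:A,y:B\vdash\Delta\Rightarrow\mathcal{G};\Gamma,z:A*B\vdash\Delta$ ($x,y$ fresh); $\mathrel{-\!\!*}R$: $(x,z\triangleright y),\mathcal{G};\Gamma,x:A\vdash y:B,\Delta\Rightarrow\mathcal{G};\Gamma\vdash z:A\mathrel{-\!\!*}B,\Delta$ ($x,y$ fresh); $*R$: $(x,y\triangleright z),\mathcal{G};\Gamma\vdash x:A,z:A*B,\Delta$ and $(x,y\triangleright z),\mathcal{G};\Gamma\vdash y:B,z:A*B,\Delta\Rightarrow(x,y\triangleright z),\mathcal{G};\Gamma\vdash z:A*B,\Delta$; $\mathrel{-\!\!*}L$: $(x,y\triangleright z),\mathcal{G};\Gamma,y:A\mathrel{-\!\!*}B\vdash x:A,\Delta$ and $(x,y\triangleright z),\mathcal{G};\Gamma,y:A\mathrel{-\!\!*}B,z:B\vdash\Delta\Rightarrow(x,y\triangleright z),\mathcal{G};\Gamma,y:A\mathrel{-\!\!*}B\vdash\Delta$; $E$: $(y,x\triangleright z),(x,y\triangleright z),\mathcal{G};\Gamma\vdash\Delta\Rightarrow(x,y\triangleright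 z),\mathcal{G};\Gamma\vdash\Delta$; $A$: $(u,w\triangleright z),(y,v\triangleright w),(x,y\triangleright z),(u,v\triangleright x),\mathcal{G};\Gamma\vdash\Delta\Rightarrow(x,y\triangleright z),(u,v\triangleright x),\mathcal{G};\Gamma\vdash\Delta$ ($w$ fresh); $U$: $(x,\epsilon\triangleright x),\mathcal{G};\Gamma\vdash\Delta\Rightarrow\mathcal{G};\Gamma\vdash\Delta$; $A_C$: $(x,w\triangleright x),(y,y\triangleright w),(x,y\triangleright x),\mathcal{G};\Gamma\vdash\Delta\Rightarrow(x,y\triangleright x),\mathcal{G};\Gamma\vdash\Delta$ ($w$ fresh); $Eq_1$: $(\epsilon,w'\triangleright w'),\mathcal{G}[w'/w];\Gamma[w'/w]\vdash\Delta[w'/w]\Rightarrow(\epsilon,w\triangleright w'),\mathcal{G};\Gamma\vdash\Delta$; $Eq_2$: same premise $\Rightarrow(\epsilon,w'\triangleright w),\mathcal{G};\Gamma\vdash\Delta$. $LS_{BBI}+P$ adds $P$: $(x,y\triangleright z),\mathcal{G}[z/w];\Gamma[z/w]\vdash\Delta[z/w]\Rightarrow(x,y\triangleright z),(x,y\triangleright w),\mathcal{G};\Gamma\vdash\Delta$. In $Eq_1,Eq_2,P$, $w$ must be a label variable.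
   Formalization: In (i), w ranges over label variables only, not over the label constant ε: with w = ε the claim fails, since ε:⊤* is an instance of the axiom ⊤*R while ⊤* is not valid (it fails at every world other than ε). *)

(* Defs.v *)
From Stdlib Require Import List Permutation PeanoNat.
Import ListNotations.

Set Implicit Arguments.
Unset Strict Implicit.
Unset Printing Implicit Defensive.

Inductive formula (Var : Type) : Type :=
| FVar (p : Var)
| FTop
| FBot
| FNeg (A : formula Var)
| FOr (A B : formula Var)
| FAnd (A B : formula Var)
| FImp (A B : formula Var)
| FEmp                              (* the multiplicative unit, top-star *)
| FStar (A B : formula Var)
| FWand (A B : formula Var).        (* the magic wand *)

(* Nonemptiness of the carrier is witnessed by [eps]. *)
Record frame : Type := Frame {
  world :> Type;
  rel : world -> world -> world -> Prop;
  eps : world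
}.

Definition identity (H : frame) : Prop :=
  forall h1 h2 : H, rel h1 (eps H) h2 <-> h1 = h2.

Definition commutativity (H : frame) : Prop :=
  forall h1 h2 h3 : H, rel h1 h2 h3 <-> rel h2 h1 h3.

Definition associativity (H : frame) : Prop :=
  forall h1 h2 h3 h4 h5 : H,
    rel h1 h5 h4 /\ rel h2 h3 h5 ->
    exists h6 : H, rel h6 h3 h4 /\ rel h1 h2 h6.

Definition partial_determinism (H : frame) : Prop :=
  forall h1 h2 h3 h4 : H, rel h1 h2 h3 /\ rel h1 h2 h4 -> h3 = h4.

Definition partial_monoidal_frame (H : frame) : Prop :=
  identity H /\ commutativity H /\ associativity H /\ partial_determinism H.

Fixpoint forces (Var : Type) (H : frame) (nu : Var -> H -> Prop)
    (h : H) (F : formula Var) {struct F} : Prop :=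
  match F with
  | FVar p => nu p h
  | FTop _ => True
  | FBot _ => False
  | FNeg A => ~ forces nu h A
  | FOr A B => forces nu h A \/ forces nu h B
  | FAnd A B => forces nu h A /\ forces nu h B
  | FImp A B => forces nu h A -> forces nu h B
  | FEmp _ => h = eps H
  | FStar A B => exists h1 h2 : H,
      rel h1 h2 h /\ forces nu h1 A /\ forces nu h2 B
  | FWand A B => forall h1 h2 : H,
      rel h h1 h2 -> forces nu h1 A -> forces nu h2 B
  end.

Definition valid_over (Var : Type) (C : frame -> Prop) (F : formula Var) : Prop :=
  forall H : frame, C H ->
  forall (nu : Var -> H -> Prop) (h : H), forces nu h F.

(* The language of sequents, in which negation and disjunction are not
   connectives but abbreviations, unfolded by [expand] below. *)
Inductive core (Var : Type) : Type :=
| CVar (p : Var)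
| CTop
| CBot
| CAnd (A B : core Var)
| CImp (A B : core Var)
| CEmp
| CStar (A B : core Var)
| CWand (A B : core Var).

Arguments CTop {Var}.
Arguments CBot {Var}.
Arguments CEmp {Var}.

Definition CNeg (Var : Type) (A : core Var) : core Var := CImp A CBot.
Definition COr (Var : Type) (A B : core Var) : core Var := CImp (CNeg A) B.

Fixpoint expand (Var : Type) (F : formula Var) : core Var :=
  match F with
  | FVar p => CVar p
  | FTop _ => CTop
  | FBot _ => CBot
  | FNeg A => CNeg (expand A)
  | FOr A B => COr (expand A) (expand B)
  | FAnd A B => CAnd (expand A) (expand B)
  | FImp A B => CImp (expand A) (expand B)
  | FEmp _ => CEmp
  | FStar A B => CStar (expand A) (expand B)
  | FWand A B => CWand (expand A) (expand B)
  end.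

(* Label variables occur only up to renaming; any countably infinite set would do. *)
Definition LVar : Type := nat.

Inductive label : Type :=
| Lv (x : LVar)
| Le.                               (* the label constant epsilon *)

(* [(a, b, c)] is the relational atom in which [a] and [b] compose to [c]. *)
Definition ratom : Type := (label * label * label)%type.

Definition lformula (Var : Type) : Type := (label * core Var)%type.

(* [sub_* y x] is the uniform replacement [y/x] of the label variable [x] by [y]. *)

Definition sub_label (y : label) (x : LVar) (a : label) : label :=
  match a with
  | Lv z => if Nat.eqb z x then y else a
  | Le => Le
  end.

Definition sub_ratom (y : label) (x : LVar) (r : ratom) : ratom :=
  match r with
  | (a, b, c) => (sub_label y x a, sub_label y x b, sub_label y x c)
  end.

Definition sub_rel (y : label) (x : LVar) (G : list ratom) : list ratom :=
  map (sub_ratom y x) G.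

Definition sub_forms (Var : Type) (y : label) (x : LVar)
    (L : list (lformula Var)) : list (lformula Var) :=
  map (fun aA => (sub_label y x (fst aA), snd aA)) L.

Definition fresh (Var : Type) (x : LVar) (G : list ratom)
    (L R : list (lformula Var)) : Prop :=
  (forall a b c : label, In (a, b, c) G -> a <> Lv x /\ b <> Lv x /\ c <> Lv x) /\
  (forall (a : label) (A : core Var), In (a, A) L \/ In (a, A) R -> a <> Lv x).

(* Derivability of the sequent G; L |- R, where the flag [cut] says whether the
   cut rule may be used.  The first component of a sequent is a finite set and
   the other two are finite multisets: all three are represented by lists, and
   [d_repr] identifies the lists that represent the same set or multiset.  In
   particular "atom, G" is a union of sets, in which G may already contain the
   atom.  Two fresh variables introduced by one rule are distinct. *)
Inductive derivable (Var : Type) (cut : bool) :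
    list ratom -> list (lformula Var) -> list (lformula Var) -> Prop :=
| d_repr G G' L L' R R' :
    (forall r, In r G <-> In r G') -> Permutation L L' -> Permutation R R' ->
    derivable cut G L R -> derivable cut G' L' R'
| d_id G L R w p :
    derivable cut G ((w, CVar p) :: L) ((w, CVar p) :: R)
| d_cut G G' L L' R R' x A :
    cut = true ->
    derivable cut G L ((x, A) :: R) ->
    derivable cut G' ((x, A) :: L') R' ->
    derivable cut (G ++ G') (L ++ L') (R ++ R')
| d_botL G L R w :
    derivable cut G ((w, CBot) :: L) R
| d_topR G L R w :
    derivable cut G L ((w, CTop) :: R)
| d_empR G L R :
    derivable cut G L ((Le, CEmp) :: R)
| d_empL G L R w :
    derivable cut ((Le, w, Le) :: G) L R ->
    derivable cut G ((w, CEmp) :: L) R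
| d_andL G L R w A B :
    derivable cut G ((w, A) :: (w, B) :: L) R ->
    derivable cut G ((w, CAnd A B) :: L) R
| d_andR G L R w A B :
    derivable cut G L ((w, A) :: R) ->
    derivable cut G L ((w, B) :: R) ->
    derivable cut G L ((w, CAnd A B) :: R)
| d_impL G L R w A B :
    derivable cut G L ((w, A) :: R) ->
    derivable cut G ((w, B) :: L) R ->
    derivable cut G ((w, CImp A B) :: L) R
| d_impR G L R w A B :
    derivable cut G ((w, A) :: L) ((w, B) :: R) ->
    derivable cut G L ((w, CImp A B) :: R)
| d_starL G L R z A B (x y : LVar) :
    x <> y ->
    fresh x G ((z, CStar A B) :: L) R ->
    fresh y G ((z, CStar A B) :: L) R ->
    derivable cut ((Lv x, Lv y, z) :: G) ((Lv x, A) :: (Lv y, B) :: L) R ->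
    derivable cut G ((z, CStar A B) :: L) R
| d_wandR G L R z A B (x y : LVar) :
    x <> y ->
    fresh x G L ((z, CWand A B) :: R) ->
    fresh y G L ((z, CWand A B) :: R) ->
    derivable cut ((Lv x, z, Lv y) :: G) ((Lv x, A) :: L) ((Lv y, B) :: R) ->
    derivable cut G L ((z, CWand A B) :: R)
| d_starR G L R x y z A B :
    derivable cut ((x, y, z) :: G) L ((x, A) :: (z, CStar A B) :: R) ->
    derivable cut ((x, y, z) :: G) L ((y, B) :: (z, CStar A B) :: R) ->
    derivable cut ((x, y, z) :: G) L ((z, CStar A B) :: R)
| d_wandL G L R x y z A B :
    derivable cut ((x, y, z) :: G) ((y, CWand A B) :: L) ((x, A) :: R) ->
    derivable cut ((x, y, z) :: G) ((y, CWand A B) :: (z, B) :: L) R ->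
    derivable cut ((x, y, z) :: G) ((y, CWand A B) :: L) R
| d_E G L R x y z :
    derivable cut ((y, x, z) :: (x, y, z) :: G) L R ->
    derivable cut ((x, y, z) :: G) L R
| d_A G L R x y z u v (w : LVar) :
    fresh w ((x, y, z) :: (u, v, x) :: G) L R ->
    derivable cut
      ((u, Lv w, z) :: (y, v, Lv w) :: (x, y, z) :: (u, v, x) :: G) L R ->
    derivable cut ((x, y, z) :: (u, v, x) :: G) L R
| d_U G L R x :
    derivable cut ((x, Le, x) :: G) L R ->
    derivable cut G L R
| d_AC G L R x y (w : LVar) :
    fresh w ((x, y, x) :: G) L R ->
    derivable cut ((x, Lv w, x) :: (y, y, Lv w) :: (x, y, x) :: G) L R ->
    derivable cut ((x, y, x) :: G) L R
| d_Eq1 G L R (w : LVar) w' :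
    derivable cut ((Le, w', w') :: sub_rel w' w G)
      (sub_forms w' w L) (sub_forms w' w R) ->
    derivable cut ((Le, Lv w, w') :: G) L R
| d_Eq2 G L R (w : LVar) w' :
    derivable cut ((Le, w', w') :: sub_rel w' w G)
      (sub_forms w' w L) (sub_forms w' w R) ->
    derivable cut ((Le, w', Lv w) :: G) L R
| d_P G L R x y z (w : LVar) :
    derivable cut ((x, y, z) :: sub_rel z w G)
      (sub_forms z w L) (sub_forms z w R) ->
    derivable cut ((x, y, z) :: (x, y, Lv w) :: G) L R.

(* Derivability of the end sequent with label variable [w], empty set of
   relational atoms and empty antecedent.  The label constant is not allowed
   here: it only tests truth at the unit world. *)
Definition derivable_at (Var : Type) (cut : bool) (w : LVar) (F : formula Var) : Prop :=
  derivable cut [] [] [(Lv w, expand F)].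

(* Main.v *)
Require Import Defs.
From Stdlib Require Import List Permutation PeanoNat Lia Cantor.
From Stdlib Require Import Classical ClassicalEpsilon.
From Stdlib Require Import FunctionalExtensionality PropExtensionality ProofIrrelevance.
Import ListNotations.

(* Soundness: no model refutes a derivable sequent, by induction on the derivation.

   Cut-free completeness: backward proof search from an underivable sequent,
   with a fair choice of rule instances, never reaches an axiom, so it yields an
   infinite sequence of underivable sequents.  The substitutions made by Eq_1,
   Eq_2 and P along the way are accumulated instead of being forgotten: two
   labels are identified when some stage gives them the same value.  The classes
   of labels form a partial monoidal frame, the rules E, A, U, Eq_1, Eq_2 and P
   giving its axioms, in which every formula met on the left is forced and every
   formula met on the right is not. *)

(** The calculus has no contraction or weakening of formulae, and the search is arranged so that
    neither has to be proved admissible and no rule has to be proved invertible: each step undoes at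
    most one rule instance on an underivable sequent, and a rule with two premises leaves at least
    one of them underivable. The price is that formulae get consumed, so a stage also remembers all
    that it ever contained, and only this memory enters the countermodel.

    The obstacle is substitution. A rule instance planned for later may find its labels replaced, so
    no fixed enumeration of labelled formulae and atoms can drive the search. Instances are
    addressed by list positions instead, and the countermodel is described with original labels,
    which each stage evaluates through the substitution composed so far. Equalities between such
    values persist, so every limit notion can be read at any sufficiently late stage. Each instance
    must come up infinitely often: the position that it names may be filled late, and the equality
    of labels that makes it applicable may arise later still. *)

Fixpoint cforces {Var : Type} {H : frame} (nu : Var -> H -> Prop)
    (h : H) (A : core Var) : Prop :=
  match A with
  | CVar p => nu p h
  | CTop => True
  | CBot => False
  | CAnd A B => cforces nu h A /\ cforces nu h B
  | CImp A B => cforces nu h A -> cforces nu h B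
  | CEmp => h = eps H
  | CStar A B => exists h1 h2 : H,
      rel h1 h2 h /\ cforces nu h1 A /\ cforces nu h2 B
  | CWand A B => forall h1 h2 : H,
      rel h h1 h2 -> cforces nu h1 A -> cforces nu h2 B
  end.

Lemma cforces_expand {Var : Type} {H : frame} (nu : Var -> H -> Prop)
    (F : formula Var) (h : H) :
  cforces nu h (expand F) <-> forces nu h F.
Proof.
  revert h; induction F as
    [p| | |A IHA|A IHA B IHB|A IHA B IHB|A IHA B IHB| |A IHA B IHB|A IHA B IHB];
    intro h; simpl; try tauto.
  - now rewrite IHA.
  - rewrite IHA, IHB. destruct (classic (forces nu h A)); tauto.
  - now rewrite IHA, IHB.
  - now rewrite IHA, IHB.
  - split; intros (h1 & h2 & Hr & HA & HB); exists h1, h2;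
      now rewrite IHA, IHB in *.
  - split; intros Hw h1 h2 Hr HA; apply IHB, (Hw h1 h2 Hr), IHA, HA.
Qed.

(** * Soundness *)

Definition holds {H : frame} (rho : label -> H) (r : ratom) : Prop :=
  match r with (a, b, c) => rel (rho a) (rho b) (rho c) end.

Definition lforces {Var : Type} {H : frame} (nu : Var -> H -> Prop)
    (rho : label -> H) (aA : lformula Var) : Prop :=
  cforces nu (rho (fst aA)) (snd aA).

Definition refutes {Var : Type} {H : frame} (nu : Var -> H -> Prop)
    (rho : label -> H) (G : list ratom) (L R : list (lformula Var)) : Prop :=
  Forall (holds rho) G /\ Forall (lforces nu rho) L /\
  Forall (fun aA => ~ lforces nu rho aA) R.

Definition update {H : frame} (rho : label -> H) (x : LVar) (h : H) (a : label) : H :=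
  match a with
  | Lv z => if Nat.eqb z x then h else rho a
  | Le => rho Le
  end.

Lemma update_same {H : frame} (rho : label -> H) (x : LVar) (h : H) :
  update rho x h (Lv x) = h.
Proof. simpl. now rewrite Nat.eqb_refl. Qed.

Lemma update_other {H : frame} (rho : label -> H) (x : LVar) (h : H) (a : label) :
  a <> Lv x -> update rho x h a = rho a.
Proof.
  destruct a as [z|]; simpl; [|reflexivity]. intros Hz.
  destruct (Nat.eqb_spec z x); congruence.
Qed.

Lemma refutes_update {Var : Type} {H : frame} (nu : Var -> H -> Prop)
    (rho : label -> H) (x : LVar) (h : H) G L R :
  fresh x G L R -> refutes nu rho G L R -> refutes nu (update rho x h) G L R.
Proof.
  intros [HG HF] (RG & RL & RR); unfold refutes; rewrite Forall_forall in *.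
  rewrite !Forall_forall in *.
  repeat split.
  - intros [[a b] c] Hin. destruct (HG a b c Hin) as (Ha & Hb & Hc).
    simpl. rewrite !update_other by assumption. exact (RG _ Hin).
  - intros [a A] Hin. unfold lforces; simpl.
    rewrite update_other by (apply (HF a A); auto). exact (RL _ Hin).
  - intros [a A] Hin. unfold lforces; simpl.
    rewrite update_other by (apply (HF a A); auto). exact (RR _ Hin).
Qed.

Lemma sub_label_equal {H : frame} (rho : label -> H) (y : label) (x : LVar) (a : label) :
  rho (Lv x) = rho y -> rho (sub_label y x a) = rho a.
Proof.
  destruct a as [z|]; simpl; [|reflexivity]. intros E.
  destruct (Nat.eqb_spec z x); congruence.
Qed.

(** Serves [Eq_1], [Eq_2] and [P]: in a partial monoidal frame the atoms of their conclusions
    already force [w] and its replacement to denote the same world, so the substitution changes no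
    value. *)
Lemma refutes_sub {Var : Type} {H : frame} (nu : Var -> H -> Prop)
    (rho : label -> H) (y : label) (x : LVar) G L R :
  rho (Lv x) = rho y -> refutes nu rho G L R ->
  refutes nu rho (sub_rel y x G) (sub_forms y x L) (sub_forms y x R).
Proof.
  intros E (RG & RL & RR). unfold refutes, sub_rel, sub_forms.
  rewrite !Forall_map. repeat split.
  - revert RG; apply Forall_impl. intros [[a b] c]; simpl.
    now rewrite !sub_label_equal.
  - revert RL; apply Forall_impl. intros [a A]; unfold lforces; simpl.
    now rewrite !sub_label_equal.
  - revert RR; apply Forall_impl. intros [a A]; unfold lforces; simpl.
    now rewrite !sub_label_equal.
Qed.

Lemma unit_left {H : frame} (h1 h2 : H) :
  partial_monoidal_frame H -> rel (eps H) h1 h2 <-> h1 = h2.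
Proof. intros (Hi & Hc & _). rewrite (Hc (eps H) h1 h2). apply Hi. Qed.

Ltac split_refutes Hr :=
  unfold refutes in Hr; repeat rewrite Forall_cons_iff in Hr.

(** A refutation of the conclusion of a rule passes to one of its premises; where there are two,
    excluded middle on a subformula or on the cut formula selects one. Rules with fresh variables
    reinterpret them, hence the quantification over [rho]. *)
Lemma soundness {Var : Type} (cut : bool) G L R (D : derivable (Var := Var) cut G L R) :
  forall (M : frame) (nu : Var -> M -> Prop) (rho : label -> M),
  partial_monoidal_frame M -> rho Le = eps M -> ~ refutes nu rho G L R.
Proof.
  induction D; intros M nu rho HF He Hr.
  - apply (IHD M nu rho HF He).
    destruct Hr as (RG & RL & RR). split; [|split].
    + rewrite Forall_forall in *. intros r Hin. apply RG. now apply H.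
    + exact (Permutation_Forall (Permutation_sym H0) RL).
    + exact (Permutation_Forall (Permutation_sym H1) RR).
  - split_refutes Hr. tauto.
  - unfold refutes in Hr. rewrite !Forall_app in Hr.
    destruct (classic (cforces nu (rho x) A)).
    + apply (IHD2 M nu rho HF He). unfold refutes. rewrite Forall_cons_iff.
      unfold lforces at 1; simpl; tauto.
    + apply (IHD1 M nu rho HF He). unfold refutes. rewrite Forall_cons_iff.
      unfold lforces at 2; simpl; tauto.
  - split_refutes Hr. unfold lforces in Hr at 1; simpl in Hr; tauto.
  - split_refutes Hr. unfold lforces in Hr at 2; simpl in Hr; tauto.
  - split_refutes Hr. unfold lforces in Hr at 2; simpl in Hr; tauto.
  - apply (IHD M nu rho HF He). unfold refutes. rewrite Forall_cons_iff.
    split_refutes Hr. unfold lforces in Hr at 1; simpl in Hr.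
    destruct Hr as (RG & (Ew & RL) & RR). simpl. rewrite He, unit_left; auto.
  - apply (IHD M nu rho HF He). unfold refutes. rewrite !Forall_cons_iff.
    split_refutes Hr. unfold lforces in *; simpl in *; tauto.
  - split_refutes Hr. unfold lforces in Hr at 2; simpl in Hr.
    destruct (classic (cforces nu (rho w) A)).
    + apply (IHD2 M nu rho HF He). unfold refutes. rewrite Forall_cons_iff.
      unfold lforces at 2; simpl; tauto.
    + apply (IHD1 M nu rho HF He). unfold refutes. rewrite Forall_cons_iff.
      unfold lforces at 2; simpl; tauto.
  - split_refutes Hr. unfold lforces in Hr at 1; simpl in Hr.
    destruct (classic (cforces nu (rho w) A)).
    + apply (IHD2 M nu rho HF He). unfold refutes. rewrite Forall_cons_iff.
      unfold lforces at 1; simpl; tauto.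
    + apply (IHD1 M nu rho HF He). unfold refutes. rewrite Forall_cons_iff.
      unfold lforces at 2; simpl; tauto.
  - apply (IHD M nu rho HF He). unfold refutes. rewrite !Forall_cons_iff.
    split_refutes Hr. unfold lforces in *; simpl in *; tauto.
  - destruct Hr as (RG & RL & RR).
    assert (Hst := Forall_inv RL). destruct Hst as (h1 & h2 & Hrel & HA & HB).
    simpl in Hrel.
    assert (Hu : refutes nu (update (update rho x h1) y h2) G ((z, CStar A B) :: L) R)
      by (now repeat apply refutes_update).
    assert (Ex : update (update rho x h1) y h2 (Lv x) = h1)
      by (rewrite update_other, update_same by congruence; reflexivity).
    assert (Ey : update (update rho x h1) y h2 (Lv y) = h2) by apply update_same.
    assert (Ez : update (update rho x h1) y h2 z = rho z)
      by (rewrite !update_other; auto;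
          [eapply (proj2 H0) | eapply (proj2 H1)]; left; left; reflexivity).
    apply (IHD M nu (update (update rho x h1) y h2) HF); [exact He|].
    unfold refutes. rewrite !Forall_cons_iff. split_refutes Hu.
    unfold lforces at 1 2, holds at 1; cbn [fst snd]. rewrite Ex, Ey, Ez. tauto.
  - destruct Hr as (RG & RL & RR).
    assert (Hwd := Forall_inv RR).
    assert (exists h1 h2 : M, rel (rho z) h1 h2 /\ cforces nu h1 A /\ ~ cforces nu h2 B)
      as (h1 & h2 & Hrel & HA & HB).
    { apply NNPP. intros Hn. apply Hwd. intros h1 h2 Hrel HA. apply NNPP.
      intros HB. apply Hn. now exists h1, h2. }
    assert (Hu : refutes nu (update (update rho x h1) y h2) G L ((z, CWand A B) :: R))
      by (now repeat apply refutes_update).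
    assert (Ex : update (update rho x h1) y h2 (Lv x) = h1)
      by (rewrite update_other, update_same by congruence; reflexivity).
    assert (Ey : update (update rho x h1) y h2 (Lv y) = h2) by apply update_same.
    assert (Ez : update (update rho x h1) y h2 z = rho z)
      by (rewrite !update_other; auto;
          [eapply (proj2 H0) | eapply (proj2 H1)]; right; left; reflexivity).
    apply (IHD M nu (update (update rho x h1) y h2) HF); [exact He|].
    unfold refutes. rewrite !Forall_cons_iff. split_refutes Hu.
    unfold lforces at 1 3, holds at 1; cbn [fst snd]. rewrite Ex, Ey, Ez.
    (* The atom of the rule lists the argument [x] first, whereas the forcing clause lists the world
       of the wand first. *)
    apply (proj1 (proj2 HF)) in Hrel. tauto.
  - split_refutes Hr.
    destruct (classic (cforces nu (rho x) A)).
    + apply (IHD2 M nu rho HF He). unfold refutes. rewrite !Forall_cons_iff.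
      unfold lforces at 2; simpl. split; [tauto|]. split; [tauto|].
      split; [|tauto]. intros HB. destruct Hr as ((Hxyz & _) & _ & (Hn & _)).
      apply Hn. now exists (rho x), (rho y).
    + apply (IHD1 M nu rho HF He). unfold refutes. rewrite !Forall_cons_iff.
      unfold lforces at 2; simpl; tauto.
  - split_refutes Hr.
    destruct (classic (cforces nu (rho x) A)).
    + apply (IHD2 M nu rho HF He). unfold refutes. rewrite !Forall_cons_iff.
      unfold lforces at 2; simpl. split; [tauto|]. split; [|tauto].
      split; [tauto|]. split; [|tauto].
      destruct Hr as ((Hxyz & _) & (Hw & _) & _).
      apply (Hw (rho x)); [|assumption]. now apply (proj1 (proj2 HF)).
    + apply (IHD1 M nu rho HF He). unfold refutes. rewrite !Forall_cons_iff.
      unfold lforces at 3; simpl; tauto.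
  - apply (IHD M nu rho HF He). unfold refutes. rewrite !Forall_cons_iff.
    split_refutes Hr. destruct Hr as ((Hxyz & RG) & RL & RR).
    assert (holds rho (y, x, z)) by now apply (proj1 (proj2 HF)). tauto.
  - assert (Hr' := Hr). split_refutes Hr. destruct Hr as ((Hxyz & Huvx & _) & _).
    destruct HF as (Hi & Hc & Ha & Hp).
    (* Associativity for y(vu), with commutativity applied to both atoms: [h] is a composite of the
       values of [y] and [v], and it interprets the fresh [w]. *)
    destruct (Ha (rho y) (rho v) (rho u) (rho z) (rho x)) as (h & Hh1 & Hh2).
    { split; now apply Hc. }
    assert (Hu := refutes_update nu rho w h _ _ _ H Hr').
    destruct H as [Hfr _].
    destruct (Hfr x y z) as (? & ? & ?); [left; reflexivity|].
    destruct (Hfr u v x) as (? & ? & _); [right; left; reflexivity|].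
    apply (IHD M nu (update rho w h)); [split; auto | exact He |].
    unfold refutes in *. rewrite !Forall_cons_iff in *.
    unfold holds at 1 2. rewrite update_same, !update_other by assumption.
    apply Hc in Hh1. tauto.
  - apply (IHD M nu rho HF He). unfold refutes. rewrite Forall_cons_iff.
    unfold refutes in Hr. simpl. rewrite He.
    split; [split; [now apply (proj1 HF)|]|]; tauto.
  - assert (Hr' := Hr). split_refutes Hr. destruct Hr as ((Hxyx & _) & _).
    destruct HF as (Hi & Hc & Ha & Hp).
    (* The same argument with the atom [(x, y, x)] in both roles, so that [h] is a composite of the
       value of [y] with itself. *)
    destruct (Ha (rho y) (rho y) (rho x) (rho x) (rho x)) as (h & Hh1 & Hh2).
    { split; now apply Hc. }
    assert (Hu := refutes_update nu rho w h _ _ _ H Hr').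
    destruct H as [Hfr _].
    destruct (Hfr x y x) as (? & ? & ?); [left; reflexivity|].
    apply (IHD M nu (update rho w h)); [split; auto | exact He |].
    unfold refutes in *. rewrite !Forall_cons_iff in *.
    unfold holds at 1 2. rewrite update_same, !update_other by assumption.
    apply Hc in Hh1. tauto.
  - apply (IHD M nu rho HF He).
    split_refutes Hr. destruct Hr as ((Hw & RG) & RL & RR). simpl in Hw.
    rewrite He, unit_left in Hw by assumption.
    destruct (refutes_sub nu rho w' w G L R Hw) as (? & ? & ?); [now split|].
    split; [constructor; [|assumption]|now split].
    simpl. rewrite He. now apply unit_left.
  - apply (IHD M nu rho HF He).
    split_refutes Hr. destruct Hr as ((Hw & RG) & RL & RR). simpl in Hw.
    rewrite He, unit_left in Hw by assumption.
    destruct (refutes_sub nu rho w' w G L R (eq_sym Hw)) as (? & ? & ?); [now split|].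
    split; [constructor; [|assumption]|now split].
    simpl. rewrite He. now apply unit_left.
  - apply (IHD M nu rho HF He).
    split_refutes Hr. destruct Hr as ((Hz & Hw & RG) & RL & RR).
    assert (E : rho (Lv w) = rho z).
    { destruct HF as (_ & _ & _ & Hp). now apply (Hp (rho x) (rho y)). }
    destruct (refutes_sub nu rho z w G L R E) as (? & ? & ?); [now split|].
    split; [constructor; assumption|now split].
Qed.

(** * Saturation *)

Definition amap (f : label -> label) (r : ratom) : ratom :=
  match r with (a, b, c) => (f a, f b, f c) end.

Definition fmap {Var : Type} (f : label -> label) (aA : lformula Var) : lformula Var :=
  (f (fst aA), snd aA).

Lemma map_amap_id (G : list ratom) : map (amap (fun a => a)) G = G.
Proof. rewrite <- (map_id G) at 2. apply map_ext. now intros [[a b] c]. Qed.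

Lemma map_fmap_id {Var : Type} (L : list (lformula Var)) :
  map (fmap (fun a => a)) L = L.
Proof. rewrite <- (map_id L) at 2. apply map_ext. now intros [a A]. Qed.

Lemma map_amap_comp (f g : label -> label) (G : list ratom) :
  map (amap g) (map (amap f) G) = map (amap (fun a => g (f a))) G.
Proof. rewrite map_map. apply map_ext. now intros [[a b] c]. Qed.

Lemma map_fmap_comp {Var : Type} (f g : label -> label) (L : list (lformula Var)) :
  map (fmap g) (map (fmap f) L) = map (fmap (fun a => g (f a))) L.
Proof. rewrite map_map. apply map_ext. now intros [a A]. Qed.

Definition below (n : nat) (a : label) : Prop :=
  match a with Lv x => x < n | Le => True end.

Definition abelow (n : nat) (r : ratom) : Prop :=
  match r with (a, b, c) => below n a /\ below n b /\ below n c end.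

Definition fbelow {Var : Type} (n : nat) (aA : lformula Var) : Prop := below n (fst aA).

Lemma below_le n m a : n <= m -> below n a -> below m a.
Proof. destruct a; simpl; lia. Qed.

Lemma below_neq n m a : below n a -> n <= m -> a <> Lv m.
Proof. destruct a; simpl; [|discriminate]. intros ? ? [= ->]. lia. Qed.

(* A stage of the proof search.  [now_ a] is what the substitutions performed
   so far have made of the label [a]; the three lists contain everything that
   has occurred so far, in terms of the current labels, and only grow at their
   ends, so that positions in them are stable. *)
Record state (Var : Type) : Type := State {
  now_ : label -> label;
  bound : nat;
  atoms : list ratom;
  lefts : list (lformula Var);
  rights : list (lformula Var)
}.
Arguments State {Var}.
Arguments now_ {Var}.
Arguments bound {Var}.
Arguments atoms {Var}.
Arguments lefts {Var}.
Arguments rights {Var}.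

(* [True] for a formula that no rule needs, [False] for one that is never
   consumed. *)
Definition doneL {Var : Type} (S : state Var) (a : label) (F : core Var) : Prop :=
  match F with
  | CVar _ | CBot | CWand _ _ => False
  | CTop => True
  | CAnd A B => In (a, A) (lefts S) /\ In (a, B) (lefts S)
  | CImp A B => In (a, A) (rights S) \/ In (a, B) (lefts S)
  | CEmp => In (Le, a, Le) (atoms S)
  | CStar A B => exists x y, In (now_ S x, now_ S y, a) (atoms S) /\
      In (now_ S x, A) (lefts S) /\ In (now_ S y, B) (lefts S)
  end.

Definition doneR {Var : Type} (S : state Var) (a : label) (F : core Var) : Prop :=
  match F with
  | CVar _ | CTop | CEmp | CStar _ _ => False
  | CBot => True
  | CAnd A B => In (a, A) (rights S) \/ In (a, B) (rights S)
  | CImp A B => In (a, A) (lefts S) /\ In (a, B) (rights S)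
  | CWand A B => exists x y, In (now_ S x, a, now_ S y) (atoms S) /\
      In (now_ S x, A) (lefts S) /\ In (now_ S y, B) (rights S)
  end.

Definition transientL {Var : Type} (F : core Var) : Prop :=
  match F with CVar _ | CBot | CWand _ _ => False | _ => True end.

Definition transientR {Var : Type} (F : core Var) : Prop :=
  match F with CVar _ | CTop | CEmp | CStar _ _ => False | _ => True end.

(** Variables from [bound S] on are untouched by the accumulated substitution, so a variable drawn
    there is fresh for the current sequent and at the same time an original label that still denotes
    itself. *)
Definition well_formed {Var : Type} (S : state Var) : Prop :=
  now_ S Le = Le /\
  (forall x, bound S <= x -> now_ S (Lv x) = Lv x) /\
  (forall a, below (bound S) a -> below (bound S) (now_ S a)) /\
  Forall (abelow (bound S)) (atoms S) /\
  Forall (fbelow (bound S)) (lefts S) /\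
  Forall (fbelow (bound S)) (rights S).

(* [L] and [R] are what is left of [lefts S] and [rights S] when the formulae
   consumed by the rules are removed.  Keeping them apart makes contraction
   unnecessary. *)
Definition unprovable_residue {Var : Type} (S : state Var)
    (L R : list (lformula Var)) : Prop :=
  ~ derivable false (atoms S) L R /\
  incl L (lefts S) /\ incl R (rights S) /\
  (forall a F, In (a, F) (lefts S) -> In (a, F) L \/ doneL S a F) /\
  (forall a F, In (a, F) (rights S) -> In (a, F) R \/ doneR S a F).

Definition good {Var : Type} (S : state Var) : Prop :=
  well_formed S /\ exists L R, unprovable_residue S L R.

(** The map [t] is kept explicit because an instruction speaks of the labels current at [S], which
    have become their images under [t] at [S']. *)
Definition extends {Var : Type} (t : label -> label) (S S' : state Var) : Prop :=
  t Le = Le /\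
  (forall a, now_ S' a = t (now_ S a)) /\
  (exists e, atoms S' = map (amap t) (atoms S) ++ e) /\
  (exists e, lefts S' = map (fmap t) (lefts S) ++ e) /\
  (exists e, rights S' = map (fmap t) (rights S) ++ e).

Lemma extends_refl {Var : Type} (S : state Var) : extends (fun a => a) S S.
Proof.
  repeat split; exists []; rewrite app_nil_r; symmetry;
    [apply map_amap_id | apply map_fmap_id | apply map_fmap_id].
Qed.

Lemma extends_trans {Var : Type} t t' (S S' S'' : state Var) :
  extends t S S' -> extends t' S' S'' -> extends (fun a => t' (t a)) S S''.
Proof.
  intros (He & Hc & (e1 & E1) & (e2 & E2) & (e3 & E3))
    (He' & Hc' & (d1 & D1) & (d2 & D2) & (d3 & D3)).
  split; [now rewrite He|]. split; [intro a; now rewrite Hc', Hc|].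
  split; [|split].
  - exists (map (amap t') e1 ++ d1).
    now rewrite D1, E1, map_app, map_amap_comp, app_assoc.
  - exists (map (fmap t') e2 ++ d2).
    now rewrite D2, E2, map_app, map_fmap_comp, app_assoc.
  - exists (map (fmap t') e3 ++ d3).
    now rewrite D3, E3, map_app, map_fmap_comp, app_assoc.
Qed.

Lemma nth_error_map_app {A B : Type} (f : A -> B) l e i x :
  nth_error l i = Some x -> nth_error (map f l ++ e) i = Some (f x).
Proof.
  intros Hx. rewrite nth_error_app1.
  - now apply map_nth_error.
  - rewrite length_map. apply nth_error_Some. congruence.
Qed.

Lemma extends_nth {Var : Type} t (S S' : state Var) :
  extends t S S' ->
  (forall i r, nth_error (atoms S) i = Some r ->
     nth_error (atoms S') i = Some (amap t r)) /\
  (forall i s, nth_error (lefts S) i = Some s ->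
     nth_error (lefts S') i = Some (fmap t s)) /\
  (forall i s, nth_error (rights S) i = Some s ->
     nth_error (rights S') i = Some (fmap t s)).
Proof.
  intros (_ & _ & (e1 & E1) & (e2 & E2) & (e3 & E3)).
  rewrite E1, E2, E3. repeat split; intros; now apply nth_error_map_app.
Qed.

Lemma extends_In {Var : Type} t (S S' : state Var) :
  extends t S S' ->
  (forall a b c, In (a, b, c) (atoms S) -> In (t a, t b, t c) (atoms S')) /\
  (forall a F, In (a, F) (lefts S) -> In (t a, F) (lefts S')) /\
  (forall a F, In (a, F) (rights S) -> In (t a, F) (rights S')).
Proof.
  intros HE. destruct (extends_nth _ _ _ HE) as (H1 & H2 & H3).
  split; [|split].
  - intros a b c [i Hi]%In_nth_error. exact (nth_error_In _ _ (H1 _ _ Hi)).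
  - intros a F [i Hi]%In_nth_error. exact (nth_error_In _ _ (H2 _ _ Hi)).
  - intros a F [i Hi]%In_nth_error. exact (nth_error_In _ _ (H3 _ _ Hi)).
Qed.

(** The witnesses of a treated star are original labels read through [now_], so the same [x] and [y]
    keep serving after any later substitution. *)
Lemma doneL_extends {Var : Type} t (S S' : state Var) a F :
  extends t S S' -> doneL S a F -> doneL S' (t a) F.
Proof.
  intros HE. destruct (extends_In _ _ _ HE) as (H1 & H2 & H3).
  destruct HE as (He & Hc & _).
  destruct F as [p| | |A B|A B| |A B|A B]; simpl; auto.
  - intros [HA HB]; auto.
  - intros [HA|HB]; auto.
  - intros HA. apply H1 in HA. now rewrite He in HA.
  - intros (x & y & Hx & HA & HB). exists x, y. rewrite !Hc. auto.
Qed.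

Lemma doneR_extends {Var : Type} t (S S' : state Var) a F :
  extends t S S' -> doneR S a F -> doneR S' (t a) F.
Proof.
  intros HE. destruct (extends_In _ _ _ HE) as (H1 & H2 & H3).
  destruct HE as (He & Hc & _).
  destruct F as [p| | |A B|A B| |A B|A B]; simpl; auto.
  - intros [HA|HB]; auto.
  - intros [HA HB]; auto.
  - intros (x & y & Hx & HA & HB). exists x, y. rewrite !Hc. auto.
Qed.

Definition grow {Var : Type} (S : state Var) n e l r : state Var :=
  State (now_ S) n (atoms S ++ e) (lefts S ++ l) (rights S ++ r).

Lemma extends_grow {Var : Type} (S : state Var) n e l r :
  extends (fun a => a) S (grow S n e l r).
Proof.
  split; [reflexivity|]. split; [reflexivity|].
  rewrite map_amap_id, !map_fmap_id. split; [now exists e|].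
  split; [now exists l | now exists r].
Qed.

(** Covers all rules that do not substitute. A formula may leave the residue only if the new entries
    make it done, as the last two hypotheses demand; formulae consumed earlier stay done because
    being done survives extension. *)
Lemma good_grow {Var : Type} (S : state Var) L R n e l r L' R' :
  well_formed S -> unprovable_residue S L R -> bound S <= n ->
  Forall (abelow n) e -> Forall (fbelow n) l -> Forall (fbelow n) r ->
  ~ derivable false (atoms S ++ e) L' R' ->
  incl L' (L ++ l) -> incl R' (R ++ r) -> incl l L' -> incl r R' ->
  (forall a F, In (a, F) L -> In (a, F) L' \/ doneL (grow S n e l r) a F) ->
  (forall a F, In (a, F) R -> In (a, F) R' \/ doneR (grow S n e l r) a F) ->
  good (grow S n e l r).
Proof.
  intros (He & Hn & Hb & HG & HL & HR) (_ & IL & IR & DL & DR) Hle Be Bl Br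
    ND IL' IR' Il Ir KL KR.
  assert (HX := extends_grow S n e l r).
  split.
  - unfold well_formed; simpl. rewrite !Forall_app.
    split; [assumption|]. split; [intros; apply Hn; lia|].
    split.
    { intros [x|] Hx; [|now rewrite He].
      destruct (Nat.lt_ge_cases x (bound S)) as [Hlt|Hge].
      - apply below_le with (bound S); [assumption|]. now apply Hb.
      - now rewrite Hn. }
    repeat split; try assumption.
    + revert HG; apply Forall_impl. intros [[a b] c]; simpl.
      intros (? & ? & ?); repeat split; now apply below_le with (bound S).
    + revert HL; apply Forall_impl. intros [a A]; apply below_le, Hle.
    + revert HR; apply Forall_impl. intros [a A]; apply below_le, Hle.
  - exists L', R'. split; [assumption|]. simpl.
    split; [|split; [|split]].
    + intros s Hs. apply IL' in Hs. rewrite in_app_iff in *. intuition.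
    + intros s Hs. apply IR' in Hs. rewrite in_app_iff in *. intuition.
    + intros a F [H|H]%in_app_iff; [|now left; apply Il].
      destruct (DL a F H) as [H'|H']; [auto|].
      right. exact (doneL_extends _ _ _ _ _ HX H').
    + intros a F [H|H]%in_app_iff; [|now left; apply Ir].
      destruct (DR a F H) as [H'|H']; [auto|].
      right. exact (doneR_extends _ _ _ _ _ HX H').
Qed.

Definition identify {Var : Type} (S : state Var) (b : label) (w : LVar) e : state Var :=
  State (fun a => sub_label b w (now_ S a)) (bound S)
    (sub_rel b w (atoms S) ++ e)
    (sub_forms b w (lefts S)) (sub_forms b w (rights S)).

Lemma extends_identify {Var : Type} (S : state Var) b w e :
  extends (sub_label b w) S (identify S b w e).
Proof.
  split; [reflexivity|]. split; [reflexivity|]. split; [now exists e|].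
  split; exists []; now rewrite app_nil_r.
Qed.

Lemma below_sub n b w a : below n b -> below n a -> below n (sub_label b w a).
Proof. destruct a as [z|]; simpl; auto. now destruct (Nat.eqb z w). Qed.

Lemma good_identify {Var : Type} (S : state Var) L R b w e :
  well_formed S -> unprovable_residue S L R ->
  below (bound S) b -> w < bound S -> Forall (abelow (bound S)) e ->
  ~ derivable false (sub_rel b w (atoms S) ++ e) (sub_forms b w L) (sub_forms b w R) ->
  good (identify S b w e).
Proof.
  intros (He & Hn & Hb & HG & HL & HR) (_ & IL & IR & DL & DR) Bb Bw Be ND.
  assert (HX := extends_identify S b w e).
  split.
  - unfold well_formed; simpl.
    split; [now rewrite He|].
    split.
    { intros x Hx. rewrite Hn by assumption. simpl.
      destruct (Nat.eqb_spec x w); [lia|reflexivity]. }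
    split; [intros a Ha; apply below_sub; auto|].
    unfold sub_rel, sub_forms. rewrite Forall_app, !Forall_map.
    repeat split; try assumption.
    + revert HG; apply Forall_impl. intros [[x y] z]; simpl.
      intros (? & ? & ?); auto using below_sub.
    + revert HL; apply Forall_impl. intros [a A]; apply below_sub, Bb.
    + revert HR; apply Forall_impl. intros [a A]; apply below_sub, Bb.
  - exists (sub_forms b w L), (sub_forms b w R). split; [assumption|]. simpl.
    split; [now apply incl_map|]. split; [now apply incl_map|].
    split.
    + intros a F ([a' F'] & [= <- <-] & H)%in_map_iff.
      destruct (DL a' F' H) as [H'|H'].
      * left. exact (in_map _ _ _ H').
      * right. exact (doneL_extends _ _ _ _ _ HX H').
    + intros a F ([a' F'] & [= <- <-] & H)%in_map_iff.
      destruct (DR a' F' H) as [H'|H'].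
      * left. exact (in_map _ _ _ H').
      * right. exact (doneR_extends _ _ _ _ _ HX H').
Qed.

(** * Backward application of single rules *)

Definition can_step {Var : Type} (S : state Var)
    (P : (label -> label) -> state Var -> Prop) : Prop :=
  exists t S', good S' /\ extends t S S' /\ P t S'.

Lemma can_step_refl {Var : Type} (S : state Var) (P : _ -> _ -> Prop) :
  good S -> P (fun a => a) S -> can_step S P.
Proof. intros. exists (fun a => a), S. auto using extends_refl. Qed.

Lemma can_step_grow {Var : Type} (S : state Var) n e l r (P : _ -> _ -> Prop) :
  good (grow S n e l r) -> P (fun a => a) (grow S n e l r) -> can_step S P.
Proof. intros. exists (fun a => a), (grow S n e l r). auto using extends_grow. Qed.

Lemma In_Permutation {A : Type} (x : A) l :
  In x l -> exists l', Permutation (x :: l') l.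
Proof.
  intros (l1 & l2 & ->)%in_split. exists (l1 ++ l2). apply Permutation_middle.
Qed.

Lemma fresh_above {Var : Type} n m G (L R : list (lformula Var)) :
  Forall (abelow n) G -> Forall (fbelow n) L -> Forall (fbelow n) R -> n <= m ->
  fresh m G L R.
Proof.
  rewrite !Forall_forall. intros HG HL HR Hle. split.
  - intros a b c H. destruct (HG _ H) as (? & ? & ?).
    repeat split; now apply below_neq with n.
  - intros a A [H|H]; eapply below_neq; try apply (HL _ H); try apply (HR _ H);
      assumption.
Qed.

Lemma derivable_repr {Var : Type} {G L R} G' L' R' :
  derivable (Var := Var) false G L R ->
  incl G G' -> incl G' G -> Permutation L L' -> Permutation R R' ->
  derivable false G' L' R'.
Proof.
  intros D I I' PL PR. refine (d_repr _ PL PR D). intro r; split; [apply I | apply I'].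
Qed.

Lemma derivable_atoms {Var : Type} {G L R} G' :
  derivable (Var := Var) false G L R -> incl G G' -> incl G' G ->
  derivable false G' L R.
Proof. intros D I I'. now refine (derivable_repr _ _ _ D I I' _ _). Qed.

Ltac solve_incl :=
  solve [ unfold incl; intros; simpl in *; rewrite ?in_app_iff in *; simpl in *; intuition ].

Lemma good_grow_keep {Var : Type} (S : state Var) L R n e l r :
  well_formed S -> unprovable_residue S L R -> bound S <= n ->
  Forall (abelow n) e -> Forall (fbelow n) l -> Forall (fbelow n) r ->
  ~ derivable false (atoms S ++ e) (l ++ L) (r ++ R) ->
  good (grow S n e l r).
Proof.
  intros HW HU Hn He Hl Hr ND.
  apply (good_grow S L R n e l r (l ++ L) (r ++ R)); auto; solve_incl.
Qed.

(** For rules that consume their principal formula: it is dropped from the residue, and [doneL] pays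
    for the loss. *)
Lemma good_grow_left {Var : Type} (S : state Var) L L1 R a F n e l r :
  well_formed S -> unprovable_residue S L R -> Permutation ((a, F) :: L1) L ->
  bound S <= n ->
  Forall (abelow n) e -> Forall (fbelow n) l -> Forall (fbelow n) r ->
  ~ derivable false (atoms S ++ e) (l ++ L1) (r ++ R) ->
  doneL (grow S n e l r) a F ->
  good (grow S n e l r).
Proof.
  intros HW HU HP Hn He Hl Hr ND HD.
  apply (good_grow S L R n e l r (l ++ L1) (r ++ R)); auto; try solve_incl.
  - intros s [H|H]%in_app_iff; apply in_or_app; [auto|left].
    apply (Permutation_in _ HP). now right.
  - intros b G [[= <- <-]|H]%(Permutation_in _ (Permutation_sym HP)); [auto|].
    left. apply in_or_app. auto.
Qed.

Lemma good_grow_right {Var : Type} (S : state Var) L R R1 a F n e l r :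
  well_formed S -> unprovable_residue S L R -> Permutation ((a, F) :: R1) R ->
  bound S <= n ->
  Forall (abelow n) e -> Forall (fbelow n) l -> Forall (fbelow n) r ->
  ~ derivable false (atoms S ++ e) (l ++ L) (r ++ R1) ->
  doneR (grow S n e l r) a F ->
  good (grow S n e l r).
Proof.
  intros HW HU HP Hn He Hl Hr ND HD.
  apply (good_grow S L R n e l r (l ++ L) (r ++ R1)); auto; try solve_incl.
  - intros s [H|H]%in_app_iff; apply in_or_app; [auto|left].
    apply (Permutation_in _ HP). now right.
  - intros b G [[= <- <-]|H]%(Permutation_in _ (Permutation_sym HP)); [auto|].
    left. apply in_or_app. auto.
Qed.

Lemma step_left {Var : Type} (S : state Var) a F :
  good S -> In (a, F) (lefts S) -> transientL F ->
  can_step S (fun t S' => doneL S' (t a) F).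
Proof.
  intros HS Hin HT. destruct (HS) as (HW & L & R & HU).
  assert (HU' := HU). destruct HU' as (ND & IL & IR & DL & DR).
  (* A formula missing from the residue was consumed earlier and is done already. *)
  destruct (DL a F Hin) as [HaL|HD]; [|now apply can_step_refl].
  destruct (In_Permutation _ _ HaL) as (L1 & HP).
  assert (HW' := HW). destruct HW' as (He & Hn & Hb & HG & HL & HR).
  assert (Ba : below (bound S) a) by (rewrite Forall_forall in HL; apply (HL _ Hin)).
  assert (BL1 : Forall (fbelow (bound S)) L1).
  { rewrite Forall_forall in *. intros s Hs. apply HL, IL.
    apply (Permutation_in _ HP). now right. }
  assert (BR : Forall (fbelow (bound S)) R).
  { rewrite Forall_forall in *. auto. }
  destruct F as [p| | |A B|A B| |A B|A B]; try contradiction.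
  - now apply can_step_refl.
  - apply (can_step_grow S (bound S) [] [(a, A); (a, B)] []); [|simpl; solve_incl].
    apply (good_grow_left S L L1 R a _ _ _ _ _ HW HU HP (le_n _));
        [repeat constructor; assumption.. | | simpl; solve_incl].
    intros D. apply ND.
    refine (derivable_repr _ _ _ (d_andL D) _ _ HP _); solve_incl || reflexivity.
  (* If the first premise is derivable, the second cannot be, or the rule would derive the current
     sequent. *)
  - destruct (classic (derivable false (atoms S) L1 ((a, A) :: R))) as [D1|D1].
    + apply (can_step_grow S (bound S) [] [(a, B)] []); [|simpl; right; solve_incl].
      apply (good_grow_left S L L1 R a _ _ _ _ _ HW HU HP (le_n _));
        [repeat constructor; assumption.. | | simpl; solve_incl].
      intros D2. rewrite app_nil_r in D2. apply ND.
      refine (derivable_repr _ _ _ (d_impL D1 D2) _ _ HP _); solve_incl || reflexivity.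
    + apply (can_step_grow S (bound S) [] [] [(a, A)]); [|simpl; left; solve_incl].
      apply (good_grow_left S L L1 R a _ _ _ _ _ HW HU HP (le_n _));
        [repeat constructor; assumption.. | | simpl; solve_incl].
      now rewrite app_nil_r.
  - apply (can_step_grow S (bound S) [(Le, a, Le)] [] []); [|simpl; solve_incl].
    apply (good_grow_left S L L1 R a _ _ _ _ _ HW HU HP (le_n _));
        [repeat constructor; assumption.. | | simpl; solve_incl].
    intros D. apply ND.
    refine (derivable_repr _ _ _ (d_empL (G := atoms S) (derivable_atoms _ D _ _)) _ _ HP _);
      solve_incl || reflexivity.
  - set (n := bound S) in *.
    assert (HD : doneL (grow S (2 + n) [(Lv n, Lv (1 + n), a)]
        [(Lv n, A); (Lv (1 + n), B)] []) a (CStar A B)).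
    { exists (Lv n), (Lv (1 + n)). simpl. rewrite !Hn by (unfold n; lia).
      repeat split; solve_incl. }
    refine (can_step_grow S _ _ _ _ _ _ HD).
    apply (good_grow_left S L L1 R a (CStar A B)); auto.
    + unfold n; lia.
    + repeat constructor. apply below_le with n; [lia|assumption].
    + repeat constructor.
    + intros D. apply ND.
      assert (BL : Forall (fbelow n) ((a, CStar A B) :: L1)) by (constructor; assumption).
      refine (derivable_repr _ _ _
        (d_starL (G := atoms S) (Nat.neq_succ_diag_r n)
           (fresh_above n n _ _ _ HG BL BR (le_n n))
           (fresh_above n (1 + n) _ _ _ HG BL BR (Nat.le_succ_diag_r n))
           (derivable_atoms _ D _ _)) _ _ HP _); solve_incl || reflexivity.
Qed.

Lemma step_right {Var : Type} (S : state Var) a F :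
  good S -> In (a, F) (rights S) -> transientR F ->
  can_step S (fun t S' => doneR S' (t a) F).
Proof.
  intros HS Hin HT. destruct (HS) as (HW & L & R & HU).
  assert (HU' := HU). destruct HU' as (ND & IL & IR & DL & DR).
  destruct (DR a F Hin) as [HaR|HD]; [|now apply can_step_refl].
  destruct (In_Permutation _ _ HaR) as (R1 & HP).
  assert (HW' := HW). destruct HW' as (He & Hn & Hb & HG & HL & HR).
  assert (Ba : below (bound S) a) by (rewrite Forall_forall in HR; apply (HR _ Hin)).
  assert (BR1 : Forall (fbelow (bound S)) R1).
  { rewrite Forall_forall in *. intros s Hs. apply HR, IR.
    apply (Permutation_in _ HP). now right. }
  assert (BL : Forall (fbelow (bound S)) L).
  { rewrite Forall_forall in *. auto. }
  destruct F as [p| | |A B|A B| |A B|A B]; try contradiction.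
  - now apply can_step_refl.
  - destruct (classic (derivable false (atoms S) L ((a, A) :: R1))) as [D1|D1].
    + apply (can_step_grow S (bound S) [] [] [(a, B)]); [|simpl; right; solve_incl].
      apply (good_grow_right S L R R1 a _ _ _ _ _ HW HU HP (le_n _));
        [repeat constructor; assumption.. | | simpl; solve_incl].
      intros D2. rewrite app_nil_r in D2. apply ND.
      refine (derivable_repr _ _ _ (d_andR D1 D2) _ _ _ HP); solve_incl || reflexivity.
    + apply (can_step_grow S (bound S) [] [] [(a, A)]); [|simpl; left; solve_incl].
      apply (good_grow_right S L R R1 a _ _ _ _ _ HW HU HP (le_n _));
        [repeat constructor; assumption.. | | simpl; solve_incl].
      now rewrite app_nil_r.
  - apply (can_step_grow S (bound S) [] [(a, A)] [(a, B)]); [|simpl; solve_incl].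
    apply (good_grow_right S L R R1 a _ _ _ _ _ HW HU HP (le_n _));
        [repeat constructor; assumption.. | | simpl; solve_incl].
    intros D. apply ND.
    refine (derivable_repr _ _ _ (d_impR D) _ _ _ HP); solve_incl || reflexivity.
  - set (n := bound S) in *.
    assert (HD : doneR (grow S (2 + n) [(Lv n, a, Lv (1 + n))]
        [(Lv n, A)] [(Lv (1 + n), B)]) a (CWand A B)).
    { exists (Lv n), (Lv (1 + n)). simpl. rewrite !Hn by (unfold n; lia).
      repeat split; solve_incl. }
    refine (can_step_grow S _ _ _ _ _ _ HD).
    apply (good_grow_right S L R R1 a (CWand A B)); auto.
    + unfold n; lia.
    + repeat constructor. apply below_le with n; [lia|assumption].
    + repeat constructor.
    + repeat constructor.
    + intros D. apply ND.
      assert (BR : Forall (fbelow n) ((a, CWand A B) :: R1)) by (constructor; assumption).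
      refine (derivable_repr _ _ _
        (d_wandR (G := atoms S) (Nat.neq_succ_diag_r n)
           (fresh_above n n _ _ _ HG BL BR (le_n n))
           (fresh_above n (1 + n) _ _ _ HG BL BR (Nat.le_succ_diag_r n))
           (derivable_atoms _ D _ _)) _ _ _ HP); solve_incl || reflexivity.
Qed.

Lemma good_below {Var : Type} (S : state Var) :
  good S ->
  (forall a b c, In (a, b, c) (atoms S) ->
     below (bound S) a /\ below (bound S) b /\ below (bound S) c) /\
  (forall a F, In (a, F) (lefts S) -> below (bound S) a) /\
  (forall a F, In (a, F) (rights S) -> below (bound S) a).
Proof.
  intros ((_ & _ & _ & HG & HL & HR) & _). rewrite Forall_forall in *.
  split; [|split].
  - intros a b c H. exact (HG _ H).
  - intros a F H. exact (HL _ H).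
  - intros a F H. exact (HR _ H).
Qed.

Lemma step_starR {Var : Type} (S : state Var) x y z A B :
  good S -> In (x, y, z) (atoms S) -> In (z, CStar A B) (rights S) ->
  can_step S (fun t S' => In (t x, A) (rights S') \/ In (t y, B) (rights S')).
Proof.
  intros HS HG HR. destruct (good_below S HS) as (BG & _ & _).
  destruct (BG _ _ _ HG) as (Bx & By & Bz).
  destruct HS as (HW & L & R & HU).
  (* [doneR] is [False] for a star, so this formula has never left the residue. *)
  destruct (proj2 (proj2 (proj2 (proj2 HU))) _ _ HR) as [Hz|[]].
  destruct (In_Permutation _ _ Hz) as (R1 & HP).
  destruct (classic (derivable false (atoms S) L ((x, A) :: R))) as [D1|D1].
  - apply (can_step_grow S (bound S) [] [] [(y, B)]); [|simpl; right; solve_incl].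
    apply (good_grow_keep S L R _ _ _ _ HW HU (le_n _)); [repeat constructor; assumption..|].
    rewrite app_nil_r. intros D2. apply (proj1 HU).
    (* The rule wants its atom at the head of the list. It already occurs in [atoms S], and atoms
       form a set, so prefixing it changes nothing. *)
    assert (I : incl (atoms S) ((x, y, z) :: atoms S)) by solve_incl.
    assert (I' : incl ((x, y, z) :: atoms S) (atoms S)) by now apply incl_cons.
    refine (derivable_repr _ _ _
      (d_starR (G := atoms S)
        (derivable_repr _ _ _ D1 I I' (Permutation_refl _) _)
        (derivable_repr _ _ _ D2 I I' (Permutation_refl _) _))
      I' I (Permutation_refl _) HP); now apply perm_skip, Permutation_sym.
  - apply (can_step_grow S (bound S) [] [] [(x, A)]); [|simpl; left; solve_incl].
    apply (good_grow_keep S L R _ _ _ _ HW HU (le_n _)); [repeat constructor; assumption..|].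
    now rewrite app_nil_r.
Qed.

Lemma step_wandL {Var : Type} (S : state Var) x y z A B :
  good S -> In (x, y, z) (atoms S) -> In (y, CWand A B) (lefts S) ->
  can_step S (fun t S' => In (t x, A) (rights S') \/ In (t z, B) (lefts S')).
Proof.
  intros HS HG HL. destruct (good_below S HS) as (BG & _ & _).
  destruct (BG _ _ _ HG) as (Bx & By & Bz).
  destruct HS as (HW & L & R & HU).
  destruct (proj1 (proj2 (proj2 (proj2 HU))) _ _ HL) as [Hy|[]].
  destruct (In_Permutation _ _ Hy) as (L1 & HP).
  destruct (classic (derivable false (atoms S) L ((x, A) :: R))) as [D1|D1].
  - apply (can_step_grow S (bound S) [] [(z, B)] []); [|simpl; right; solve_incl].
    apply (good_grow_keep S L R _ _ _ _ HW HU (le_n _)); [repeat constructor; assumption..|].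
    rewrite app_nil_r. intros D2. apply (proj1 HU).
    assert (I : incl (atoms S) ((x, y, z) :: atoms S)) by solve_incl.
    assert (I' : incl ((x, y, z) :: atoms S) (atoms S)) by now apply incl_cons.
    refine (derivable_repr _ _ _
      (d_wandL (G := atoms S)
        (derivable_repr _ _ _ D1 I I' (Permutation_sym HP) (Permutation_refl _))
        (derivable_repr _ _ _ D2 I I' _ (Permutation_refl _)))
      I' I HP (Permutation_refl _)).
    transitivity ((z, B) :: (y, CWand A B) :: L1); [|apply perm_swap].
    now apply perm_skip, Permutation_sym.
  - apply (can_step_grow S (bound S) [] [] [(x, A)]); [|simpl; left; solve_incl].
    apply (good_grow_keep S L R _ _ _ _ HW HU (le_n _)); [repeat constructor; assumption..|].
    now rewrite app_nil_r.
Qed.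

Lemma step_E {Var : Type} (S : state Var) x y z :
  good S -> In (x, y, z) (atoms S) ->
  can_step S (fun t S' => In (t y, t x, t z) (atoms S')).
Proof.
  intros HS HG. destruct (good_below S HS) as (BG & _ & _).
  destruct (BG _ _ _ HG) as (Bx & By & Bz). destruct HS as (HW & L & R & HU).
  apply (can_step_grow S (bound S) [(y, x, z)] [] []); [|simpl; solve_incl].
  apply (good_grow_keep S L R _ _ _ _ HW HU (le_n _)); [repeat constructor; assumption..|].
  intros D. apply (proj1 HU).
  refine (derivable_atoms _ (d_E (G := atoms S) (x := x) (y := y) (z := z)
    (derivable_atoms _ D _ _)) _ _); try solve_incl.
  - unfold incl; simpl; intros r Hr; rewrite in_app_iff; simpl; intuition (subst; auto).
  - now apply incl_cons.
Qed.

(** The two atoms may be one and the same, with [u = x], [v = y] and [z = x]: atoms form a set, so a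
    single atom may be listed twice and the rule still applies. *)
Lemma step_A {Var : Type} (S : state Var) x y z u v :
  good S -> In (x, y, z) (atoms S) -> In (u, v, x) (atoms S) ->
  can_step S (fun t S' => exists w,
    In (t u, now_ S' w, t z) (atoms S') /\ In (t y, t v, now_ S' w) (atoms S')).
Proof.
  intros HS HG HG'. destruct (good_below S HS) as (BG & BL & BR).
  destruct (BG _ _ _ HG) as (Bx & By & Bz). destruct (BG _ _ _ HG') as (Bu & Bv & _).
  destruct HS as (HW & L & R & HU).
  set (n := bound S) in *. set (w := Lv n).
  apply (can_step_grow S (1 + n) [(u, w, z); (y, v, w)] [] []).
  2: { exists w. simpl. unfold w. rewrite (proj1 (proj2 HW)) by (unfold n; lia).
       split; solve_incl. }
  apply (good_grow_keep S L R _ _ _ _ HW HU); [unfold n; lia|..].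
  { assert (forall a, below n a -> below (1 + n) a)
      by (intros a; apply below_le; lia).
    repeat constructor; simpl; auto. }
  1,2: constructor.
  intros D. apply (proj1 HU).
  assert (I : incl ((x, y, z) :: (u, v, x) :: atoms S) (atoms S))
    by (repeat apply incl_cons; solve_incl).
  refine (derivable_atoms _ (d_A (G := atoms S) (x := x) (y := y) (z := z) (u := u)
    (v := v) (w := n) _ (derivable_atoms _ D _ _)) I _); try solve_incl.
  - destruct HU as (_ & IL & IR & _).
    split.
    + intros a b c Ha%I. destruct (BG _ _ _ Ha) as (? & ? & ?).
      repeat split; now apply below_neq with n.
    + intros a A [Ha|Ha]; apply below_neq with n; auto;
        [eapply BL, IL, Ha | eapply BR, IR, Ha].
  - do 2 (apply incl_cons; [apply in_or_app; right; simpl; auto|]).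
    now apply incl_appl.
Qed.

(** Stated for every original label, introduced or not, because every label names a world of the
    countermodel and the identity condition must hold there. *)
Lemma step_U {Var : Type} (S : state Var) a :
  good S -> can_step S (fun t S' => In (now_ S' a, Le, now_ S' a) (atoms S')).
Proof.
  intros HS. destruct HS as (HW & L & R & HU).
  (* A variable not yet introduced may lie above the bound, which is then raised past it. *)
  set (n := match a with Lv x => bound S + x | Le => 0 end).
  apply (can_step_grow S (1 + bound S + n) [(now_ S a, Le, now_ S a)] [] []);
    [|simpl; solve_incl].
  assert (Ba : below (1 + bound S + n) (now_ S a)).
  { destruct HW as (He & Hn & Hb & _). destruct a as [x|]; [|now rewrite He].
    destruct (Nat.lt_ge_cases x (bound S)) as [Hx|Hx].
    - apply below_le with (bound S); [lia|]. now apply Hb.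
    - rewrite Hn by assumption. simpl; lia. }
  apply (good_grow_keep S L R _ _ _ _ HW HU); [lia|repeat constructor; assumption..|].
  intros D. apply (proj1 HU). apply (d_U (x := now_ S a)).
  refine (derivable_atoms _ D _ _); solve_incl.
Qed.

Lemma sub_label_eq b w : sub_label b w (Lv w) = b.
Proof. simpl. now rewrite Nat.eqb_refl. Qed.

Lemma sub_label_neq b w a : a <> Lv w -> sub_label b w a = a.
Proof.
  destruct a as [z|]; simpl; [|reflexivity]. destruct (Nat.eqb_spec z w); congruence.
Qed.

Lemma can_step_identify {Var : Type} (S : state Var) b w e :
  b <> Lv w -> good (identify S b w e) ->
  can_step S (fun t _ => t b = t (Lv w)).
Proof.
  intros Hb HS. exists (sub_label b w), (identify S b w e).
  rewrite sub_label_eq, sub_label_neq by assumption.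
  auto using extends_identify.
Qed.

Lemma can_step_sym {Var : Type} (S : state Var) a b :
  can_step S (fun t _ => t a = t b) -> can_step S (fun t _ => t b = t a).
Proof. intros (t & S' & HS & HE & E). now exists t, S'. Qed.

Lemma step_Eq {Var : Type} (S : state Var) a b :
  good S -> In (Le, a, b) (atoms S) -> can_step S (fun t _ => t a = t b).
Proof.
  intros HS HG. destruct (good_below S HS) as (BG & _ & _).
  destruct (BG _ _ _ HG) as (_ & Ba & Bb).
  assert (HS' := HS). destruct HS' as (HW & L & R & HU).
  assert (I : incl ((Le, a, b) :: atoms S) (atoms S)) by now apply incl_cons.
  assert (Hab : {a = b} + {a <> b}) by (repeat decide equality).
  destruct Hab as [<-|Hab]; [now apply can_step_refl|].
  destruct a as [w|]; [|destruct b as [w|]; [|contradiction]].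
  - apply can_step_sym, (can_step_identify S b w []); [congruence|].
    apply (good_identify S L R b w [] HW HU Bb Ba (Forall_nil _)). intros D.
    apply (proj1 HU).
    refine (derivable_atoms _ (d_Eq1 (derivable_atoms _ D _ _)) I _); try solve_incl.
    (* The atom [(Le, b, b)] of the premise is the image of [(Le, Lv w, b)] under the substitution,
       so no extra atom has to be stored. *)
    apply incl_cons; [|solve_incl]. rewrite app_nil_r.
    apply (in_map (sub_ratom b w)) in HG. simpl in HG.
    rewrite Nat.eqb_refl, sub_label_neq in HG by congruence. exact HG.
  - apply (can_step_identify S Le w []); [congruence|].
    apply (good_identify S L R Le w [] HW HU Ba Bb (Forall_nil _)). intros D.
    apply (proj1 HU).
    refine (derivable_atoms _ (d_Eq2 (derivable_atoms _ D _ _)) I _); try solve_incl.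
    apply incl_cons; [|solve_incl]. rewrite app_nil_r.
    apply (in_map (sub_ratom Le w)) in HG. simpl in HG.
    rewrite Nat.eqb_refl in HG. exact HG.
Qed.

(* The premise of P keeps the atom [(x, y, z)] unsubstituted, even when [w] is
   [x] or [y], so it is added to the stage. *)
Lemma step_P_var {Var : Type} (S : state Var) x y z w :
  good S -> In (x, y, z) (atoms S) -> In (x, y, Lv w) (atoms S) -> z <> Lv w ->
  can_step S (fun t _ => t z = t (Lv w)).
Proof.
  intros HS HG HG' Hz. destruct (good_below S HS) as (BG & _ & _).
  destruct (BG _ _ _ HG) as (Bx & By & Bz). destruct (BG _ _ _ HG') as (_ & _ & Bw).
  destruct HS as (HW & L & R & HU).
  apply (can_step_identify S z w [(x, y, z)]); [assumption|].
  apply (good_identify S L R z w _ HW HU Bz Bw); [repeat constructor; assumption|].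
  intros D. apply (proj1 HU).
  assert (I : incl ((x, y, z) :: (x, y, Lv w) :: atoms S) (atoms S))
    by (repeat apply incl_cons; solve_incl).
  refine (derivable_atoms _ (d_P (derivable_atoms _ D _ _)) I _); solve_incl.
Qed.

Lemma step_P {Var : Type} (S : state Var) x y z z' :
  good S -> In (x, y, z) (atoms S) -> In (x, y, z') (atoms S) ->
  can_step S (fun t _ => t z = t z').
Proof.
  intros HS HG HG'.
  assert (Hzz : {z = z'} + {z <> z'}) by (repeat decide equality).
  destruct Hzz as [<-|Hz]; [now apply can_step_refl|].
  destruct z' as [w|]; [now apply (step_P_var S x y z w)|].
  destruct z as [w|]; [|contradiction].
  apply can_step_sym. apply (step_P_var S x y Le w); auto.
Qed.

(* What stage [S'] owes to stage [S] if it handles the instruction of kind [k]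
   for the list positions [i] and [j]. *)
Definition obligation {Var : Type} (k i j : nat) (S : state Var)
    (t : label -> label) (S' : state Var) : Prop :=
  match k with
  | 0 => forall a F, nth_error (lefts S) i = Some (a, F) -> transientL F ->
      doneL S' (t a) F
  | 1 => forall a F, nth_error (rights S) i = Some (a, F) -> transientR F ->
      doneR S' (t a) F
  | 2 => forall x y z A B, nth_error (atoms S) i = Some (x, y, z) ->
      nth_error (rights S) j = Some (z, CStar A B) ->
      In (t x, A) (rights S') \/ In (t y, B) (rights S')
  | 3 => forall x y z A B, nth_error (atoms S) i = Some (x, y, z) ->
      nth_error (lefts S) j = Some (y, CWand A B) ->
      In (t x, A) (rights S') \/ In (t z, B) (lefts S')
  | 4 => forall x y z, nth_error (atoms S) i = Some (x, y, z) ->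
      In (t y, t x, t z) (atoms S')
  | 5 => forall x y z u v, nth_error (atoms S) i = Some (x, y, z) ->
      nth_error (atoms S) j = Some (u, v, x) ->
      exists w, In (t u, now_ S' w, t z) (atoms S') /\
        In (t y, t v, now_ S' w) (atoms S')
  | 6 => let a := match i with 0 => Le | Datatypes.S x => Lv x end in
      In (now_ S' a, Le, now_ S' a) (atoms S')
  | 7 => forall a b, nth_error (atoms S) i = Some (Le, a, b) -> t a = t b
  | _ => forall x y z z', nth_error (atoms S) i = Some (x, y, z) ->
      nth_error (atoms S) j = Some (x, y, z') -> t z = t z'
  end.

Lemma can_step_if {Var : Type} (S : state Var) (C : Prop) (P : _ -> _ -> Prop) :
  good S -> (C -> can_step S P) -> can_step S (fun t S' => C -> P t S').
Proof.
  intros HS HP. destruct (classic C) as [HC|HC].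
  - destruct (HP HC) as (t & S' & ? & ? & ?). now exists t, S'.
  - now apply can_step_refl.
Qed.

Lemma can_step_impl {Var : Type} (S : state Var) (P Q : _ -> _ -> Prop) :
  (forall t S', P t S' -> Q t S') -> can_step S P -> can_step S Q.
Proof. intros HPQ (t & S' & HS & HE & HP). exists t, S'. auto. Qed.

Lemma step {Var : Type} (S : state Var) k i j :
  good S -> can_step S (obligation k i j S).
Proof.
  intros HS.
  destruct k as [|[|[|[|[|[|[|[|k]]]]]]]]; unfold obligation.
  - destruct (nth_error (lefts S) i) as [[a F]|] eqn:Ei;
      [|now apply can_step_refl].
    apply nth_error_In in Ei.
    apply can_step_impl with
      (2 := can_step_if S _ _ HS (step_left S a F HS Ei)).
    now intros t S' H ? ? [= <- <-].
  - destruct (nth_error (rights S) i) as [[a F]|] eqn:Ei;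
      [|now apply can_step_refl].
    apply nth_error_In in Ei.
    apply can_step_impl with
      (2 := can_step_if S _ _ HS (step_right S a F HS Ei)).
    now intros t S' H ? ? [= <- <-].
  - destruct (nth_error (atoms S) i) as [[[x y] z]|] eqn:Ei;
      [|now apply can_step_refl].
    destruct (nth_error (rights S) j) as [[a F]|] eqn:Ej;
      [|now apply can_step_refl].
    apply nth_error_In in Ei, Ej.
    destruct F as [| | | | | |A B|]; try now apply can_step_refl.
    destruct (classic (a = z)) as [->|Hz];
      [|apply can_step_refl; [assumption|]; intros; congruence].
    apply can_step_impl with (2 := step_starR S x y z A B HS Ei Ej).
    now intros t S' H ? ? ? ? ? [= <- <- <-] [= <- <-].
  - destruct (nth_error (atoms S) i) as [[[x y] z]|] eqn:Ei;
      [|now apply can_step_refl].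
    destruct (nth_error (lefts S) j) as [[a F]|] eqn:Ej;
      [|now apply can_step_refl].
    apply nth_error_In in Ei, Ej.
    destruct F as [| | | | | | |A B]; try now apply can_step_refl.
    destruct (classic (a = y)) as [->|Hz];
      [|apply can_step_refl; [assumption|]; intros; congruence].
    apply can_step_impl with (2 := step_wandL S x y z A B HS Ei Ej).
    now intros t S' H ? ? ? ? ? [= <- <- <-] [= <- <-].
  - destruct (nth_error (atoms S) i) as [[[x y] z]|] eqn:Ei;
      [|now apply can_step_refl].
    apply nth_error_In in Ei.
    apply can_step_impl with (2 := step_E S x y z HS Ei).
    now intros t S' H ? ? ? [= <- <- <-].
  - destruct (nth_error (atoms S) i) as [[[x y] z]|] eqn:Ei;
      [|now apply can_step_refl].
    destruct (nth_error (atoms S) j) as [[[u v] x']|] eqn:Ej;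
      [|now apply can_step_refl].
    apply nth_error_In in Ei, Ej.
    destruct (classic (x' = x)) as [->|Hx];
      [|apply can_step_refl; [assumption|]; intros; congruence].
    apply can_step_impl with (2 := step_A S x y z u v HS Ei Ej).
    now intros t S' H ? ? ? ? ? [= <- <- <-] [= <- <-].
  - now apply step_U.
  - destruct (nth_error (atoms S) i) as [[[x y] z]|] eqn:Ei;
      [|now apply can_step_refl].
    apply nth_error_In in Ei.
    destruct (classic (x = Le)) as [->|Hx];
      [|apply can_step_refl; [assumption|]; intros; congruence].
    apply can_step_impl with (2 := step_Eq S y z HS Ei).
    now intros t S' H ? ? [= <- <-].
  - destruct (nth_error (atoms S) i) as [[[x y] z]|] eqn:Ei;
      [|now apply can_step_refl].
    destruct (nth_error (atoms S) j) as [[[x' y'] z']|] eqn:Ej;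
      [|now apply can_step_refl].
    apply nth_error_In in Ei, Ej.
    destruct (classic (x' = x /\ y' = y)) as [[-> ->]|Hx];
      [|apply can_step_refl; [assumption|]; intros; exfalso; apply Hx; split; congruence].
    apply can_step_impl with (2 := step_P S x y z z' HS Ei Ej).
    now intros t S' H ? ? ? ? [= <- <- <-] [= <-].
Qed.

(** * Fair scheduling of the instructions *)

Definition schedule (n : nat) : nat * nat * nat :=
  let (p, q) := Cantor.of_nat n in
  let (k, _) := Cantor.of_nat p in
  let (i, j) := Cantor.of_nat q in (k, i, j).

(** The component that [schedule] discards is padding: storing [n] in it yields a code of the same
    instruction that is at least [n]. *)
Lemma schedule_fair k i j n : exists m, n <= m /\ schedule m = (k, i, j).
Proof.
  exists (Cantor.to_nat (Cantor.to_nat (k, n), Cantor.to_nat (i, j))). split.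
  - assert (H1 := Cantor.to_nat_non_decreasing k n).
    assert (H2 := Cantor.to_nat_non_decreasing (Cantor.to_nat (k, n)) (Cantor.to_nat (i, j))).
    lia.
  - unfold schedule. now rewrite !Cantor.cancel_of_to.
Qed.

Definition fair {Var : Type} (f : nat -> state Var) : Prop :=
  forall n, good (f n) /\
    let '(k, i, j) := schedule n in
    exists t, extends t (f n) (f (1 + n)) /\ obligation k i j (f n) t (f (1 + n)).

Lemma fair_exists {Var : Type} (S : state Var) :
  good S -> exists f, f 0 = S /\ fair f.
Proof.
  intros HS.
  (* Bundling a state with its goodness turns the choice of a successor into a total function, which
     can be iterated. *)
  assert (next : forall (n : nat) (T : {T : state Var | good T}),
    {T' : {T' : state Var | good T'} |
      let '(k, i, j) := schedule n in
      exists t, extends t (proj1_sig T) (proj1_sig T') /\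
        obligation k i j (proj1_sig T) t (proj1_sig T')}).
  { intros n [T HT]. apply constructive_indefinite_description.
    destruct (schedule n) as [[k i] j].
    destruct (step T k i j HT) as (t & T' & HT' & HE & HO).
    exists (exist _ T' HT'), t. auto. }
  pose (g := nat_rect (fun _ => {T : state Var | good T}) (exist _ S HS)
    (fun n T => proj1_sig (next n T))).
  exists (fun n => proj1_sig (g n)). split; [reflexivity|].
  intros n. split; [apply (proj2_sig (g n))|].
  exact (proj2_sig (next n (g n))).
Qed.

(** * The countermodel *)

(** The arguments are original labels, which never change. One stage suffices as a witness, since
    extensions preserve what it shows. *)
Definition lim_rel {Var : Type} (f : nat -> state Var) (a b c : label) : Prop :=
  exists n, In (now_ (f n) a, now_ (f n) b, now_ (f n) c) (atoms (f n)).

Definition lim_left {Var : Type} (f : nat -> state Var) (a : label) (F : core Var) : Prop :=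
  exists n, In (now_ (f n) a, F) (lefts (f n)).

Definition lim_right {Var : Type} (f : nat -> state Var) (a : label) (F : core Var) : Prop :=
  exists n, In (now_ (f n) a, F) (rights (f n)).

Definition lim_eq {Var : Type} (f : nat -> state Var) (a b : label) : Prop :=
  exists n, now_ (f n) a = now_ (f n) b.

Lemma fair_extends {Var : Type} (f : nat -> state Var) n m :
  fair f -> n <= m -> exists t, extends t (f n) (f m).
Proof.
  intros Hf. induction 1 as [|m Hm (t & Ht)].
  - exists (fun a => a). apply extends_refl.
  - destruct (Hf m) as [_ Hs]. destruct (schedule m) as [[k i] j].
    destruct Hs as (t' & Ht' & _). eexists. eapply extends_trans; eassumption.
Qed.

(** A single position works at all later stages. This lets several limit facts be moved to a common
    stage and lets one instruction, fixed in advance, treat them. *)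
Lemma lim_rel_eventually {Var : Type} (f : nat -> state Var) a b c :
  fair f -> lim_rel f a b c -> exists n i, forall m, n <= m ->
  nth_error (atoms (f m)) i = Some (now_ (f m) a, now_ (f m) b, now_ (f m) c).
Proof.
  intros Hf (n & [i Hi]%In_nth_error). exists n, i. intros m Hm.
  destruct (fair_extends f n m Hf Hm) as (t & Ht).
  rewrite (proj1 (extends_nth _ _ _ Ht) _ _ Hi). simpl.
  now rewrite !(proj1 (proj2 Ht)).
Qed.

Lemma lim_left_eventually {Var : Type} (f : nat -> state Var) a F :
  fair f -> lim_left f a F -> exists n i, forall m, n <= m ->
  nth_error (lefts (f m)) i = Some (now_ (f m) a, F).
Proof.
  intros Hf (n & [i Hi]%In_nth_error). exists n, i. intros m Hm.
  destruct (fair_extends f n m Hf Hm) as (t & Ht).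
  rewrite (proj1 (proj2 (extends_nth _ _ _ Ht)) _ _ Hi). unfold fmap; simpl.
  now rewrite !(proj1 (proj2 Ht)).
Qed.

Lemma lim_right_eventually {Var : Type} (f : nat -> state Var) a F :
  fair f -> lim_right f a F -> exists n i, forall m, n <= m ->
  nth_error (rights (f m)) i = Some (now_ (f m) a, F).
Proof.
  intros Hf (n & [i Hi]%In_nth_error). exists n, i. intros m Hm.
  destruct (fair_extends f n m Hf Hm) as (t & Ht).
  rewrite (proj2 (proj2 (extends_nth _ _ _ Ht)) _ _ Hi). unfold fmap; simpl.
  now rewrite !(proj1 (proj2 Ht)).
Qed.

Lemma lim_eq_eventually {Var : Type} (f : nat -> state Var) a b :
  fair f -> lim_eq f a b -> exists n, forall m, n <= m ->
  now_ (f m) a = now_ (f m) b.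
Proof.
  intros Hf (n & E). exists n. intros m Hm.
  destruct (fair_extends f n m Hf Hm) as (t & _ & Ht & _). now rewrite !Ht, E.
Qed.

Lemma fair_obligation {Var : Type} (f : nat -> state Var) k i j n :
  fair f -> exists m t, n <= m /\
    (forall a, now_ (f (1 + m)) a = t (now_ (f m) a)) /\
    obligation k i j (f m) t (f (1 + m)).
Proof.
  intros Hf. destruct (schedule_fair k i j n) as (m & Hm & Es).
  destruct (Hf m) as [_ Hs]. rewrite Es in Hs. destruct Hs as (t & Ht & Ho).
  exists m, t. split; [assumption|]. split; [apply Ht | assumption].
Qed.

Lemma lim_eq_trans {Var : Type} (f : nat -> state Var) a b c :
  fair f -> lim_eq f a b -> lim_eq f b c -> lim_eq f a c.
Proof.
  intros Hf H1 H2.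
  destruct (lim_eq_eventually f a b Hf H1) as (n & Hn).
  destruct (lim_eq_eventually f b c Hf H2) as (m & Hm).
  exists (n + m). rewrite Hn, Hm by lia. reflexivity.
Qed.

Lemma lim_eq_sym {Var : Type} (f : nat -> state Var) a b :
  lim_eq f a b -> lim_eq f b a.
Proof. intros (n & E). now exists n. Qed.

Lemma lim_rel_cong {Var : Type} (f : nat -> state Var) a b c a' b' c' :
  fair f -> lim_eq f a a' -> lim_eq f b b' -> lim_eq f c c' ->
  lim_rel f a b c -> lim_rel f a' b' c'.
Proof.
  intros Hf Ha Hb Hc Hr.
  destruct (lim_eq_eventually f _ _ Hf Ha) as (n1 & H1).
  destruct (lim_eq_eventually f _ _ Hf Hb) as (n2 & H2).
  destruct (lim_eq_eventually f _ _ Hf Hc) as (n3 & H3).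
  destruct (lim_rel_eventually f _ _ _ Hf Hr) as (n4 & i & H4).
  exists (n1 + n2 + n3 + n4). rewrite <- H1, <- H2, <- H3 by lia.
  apply nth_error_In with i. apply H4. lia.
Qed.

Lemma lim_right_cong {Var : Type} (f : nat -> state Var) a a' F :
  fair f -> lim_eq f a a' -> lim_right f a F -> lim_right f a' F.
Proof.
  intros Hf Ha Hr.
  destruct (lim_eq_eventually f _ _ Hf Ha) as (n1 & H1).
  destruct (lim_right_eventually f _ _ Hf Hr) as (n2 & i & H2).
  exists (n1 + n2). rewrite <- H1 by lia.
  apply nth_error_In with i. apply H2. lia.
Qed.

Lemma lim_left_cong {Var : Type} (f : nat -> state Var) a a' F :
  fair f -> lim_eq f a a' -> lim_left f a F -> lim_left f a' F.
Proof.
  intros Hf Ha Hr.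
  destruct (lim_eq_eventually f _ _ Hf Ha) as (n1 & H1).
  destruct (lim_left_eventually f _ _ Hf Hr) as (n2 & i & H2).
  exists (n1 + n2). rewrite <- H1 by lia.
  apply nth_error_In with i. apply H2. lia.
Qed.

Lemma lim_unit {Var : Type} (f : nat -> state Var) a :
  fair f -> lim_rel f a Le a.
Proof.
  intros Hf.
  destruct (fair_obligation f 6 (match a with Le => 0 | Lv x => S x end) 0 0 Hf)
    as (m & t & _ & _ & Ho).
  exists (1 + m). destruct (Hf (1 + m)) as (((He & _) & _) & _). rewrite He.
  now destruct a.
Qed.

Lemma lim_comm {Var : Type} (f : nat -> state Var) a b c :
  fair f -> lim_rel f a b c -> lim_rel f b a c.
Proof.
  intros Hf Hr. destruct (lim_rel_eventually f _ _ _ Hf Hr) as (n & i & Hi).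
  destruct (fair_obligation f 4 i 0 n Hf) as (m & t & Hm & Ht & Ho).
  exists (1 + m). rewrite !Ht. apply Ho, Hi, Hm.
Qed.

Lemma lim_assoc {Var : Type} (f : nat -> state Var) x y z u v :
  fair f -> lim_rel f x y z -> lim_rel f u v x ->
  exists w, lim_rel f u w z /\ lim_rel f y v w.
Proof.
  intros Hf Hr Hr'. destruct (lim_rel_eventually f _ _ _ Hf Hr) as (n & i & Hi).
  destruct (lim_rel_eventually f _ _ _ Hf Hr') as (n' & i' & Hi').
  destruct (fair_obligation f 5 i i' (n + n') Hf) as (m & t & Hm & Ht & Ho).
  destruct (Ho _ _ _ _ _ (Hi m ltac:(lia)) (Hi' m ltac:(lia))) as (w & H1 & H2).
  exists w. split; exists (1 + m); now rewrite !Ht in *.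
Qed.

Lemma lim_unit_eq {Var : Type} (f : nat -> state Var) a b :
  fair f -> lim_rel f Le a b -> lim_eq f a b.
Proof.
  intros Hf Hr. destruct (lim_rel_eventually f _ _ _ Hf Hr) as (n & i & Hi).
  destruct (fair_obligation f 7 i 0 n Hf) as (m & t & Hm & Ht & Ho).
  exists (1 + m). rewrite !Ht. apply Ho. rewrite (Hi m Hm).
  destruct (Hf m) as (((He & _) & _) & _). now rewrite He.
Qed.

Lemma lim_functional {Var : Type} (f : nat -> state Var) a b c c' :
  fair f -> lim_rel f a b c -> lim_rel f a b c' -> lim_eq f c c'.
Proof.
  intros Hf Hr Hr'. destruct (lim_rel_eventually f _ _ _ Hf Hr) as (n & i & Hi).
  destruct (lim_rel_eventually f _ _ _ Hf Hr') as (n' & i' & Hi').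
  destruct (fair_obligation f 8 i i' (n + n') Hf) as (m & t & Hm & Ht & Ho).
  exists (1 + m). rewrite !Ht. eapply Ho; [apply Hi | apply Hi']; lia.
Qed.

Lemma lim_starR {Var : Type} (f : nat -> state Var) a b c A B :
  fair f -> lim_rel f a b c -> lim_right f c (CStar A B) ->
  lim_right f a A \/ lim_right f b B.
Proof.
  intros Hf Hr Hr'. destruct (lim_rel_eventually f _ _ _ Hf Hr) as (n & i & Hi).
  destruct (lim_right_eventually f _ _ Hf Hr') as (n' & i' & Hi').
  destruct (fair_obligation f 2 i i' (n + n') Hf) as (m & t & Hm & Ht & Ho).
  destruct (Ho _ _ _ _ _ (Hi m ltac:(lia)) (Hi' m ltac:(lia))) as [H|H];
    [left | right]; exists (1 + m); now rewrite Ht.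
Qed.

Lemma lim_wandL {Var : Type} (f : nat -> state Var) a b c A B :
  fair f -> lim_rel f a b c -> lim_left f b (CWand A B) ->
  lim_right f a A \/ lim_left f c B.
Proof.
  intros Hf Hr Hr'. destruct (lim_rel_eventually f _ _ _ Hf Hr) as (n & i & Hi).
  destruct (lim_left_eventually f _ _ Hf Hr') as (n' & i' & Hi').
  destruct (fair_obligation f 3 i i' (n + n') Hf) as (m & t & Hm & Ht & Ho).
  destruct (Ho _ _ _ _ _ (Hi m ltac:(lia)) (Hi' m ltac:(lia))) as [H|H];
    [left | right]; exists (1 + m); now rewrite Ht.
Qed.

Lemma lim_doneL {Var : Type} (f : nat -> state Var) a F :
  fair f -> lim_left f a F -> transientL F -> exists n, doneL (f n) (now_ (f n) a) F.
Proof.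
  intros Hf Hr HT. destruct (lim_left_eventually f _ _ Hf Hr) as (n & i & Hi).
  destruct (fair_obligation f 0 i 0 n Hf) as (m & t & Hm & Ht & Ho).
  exists (1 + m). rewrite Ht. apply Ho; auto.
Qed.

Lemma lim_doneR {Var : Type} (f : nat -> state Var) a F :
  fair f -> lim_right f a F -> transientR F -> exists n, doneR (f n) (now_ (f n) a) F.
Proof.
  intros Hf Hr HT. destruct (lim_right_eventually f _ _ Hf Hr) as (n & i & Hi).
  destruct (fair_obligation f 1 i 0 n Hf) as (m & t & Hm & Ht & Ho).
  exists (1 + m). rewrite Ht. apply Ho; auto.
Qed.

(** Formulae of axioms are never consumed, so one that was ever met is still in the residue and
    would make it derivable. *)
Lemma good_not_left_bot {Var : Type} (S : state Var) a :
  good S -> ~ In (a, CBot) (lefts S).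
Proof.
  intros (_ & L & R & ND & _ & _ & DL & _) Ha.
  destruct (DL _ _ Ha) as [HL|[]]. destruct (In_Permutation _ _ HL) as (L1 & HP).
  apply ND. refine (derivable_repr _ _ _ (d_botL _ (atoms S) L1 R a) _ _ HP _);
    auto using incl_refl.
Qed.

Lemma good_not_right_top {Var : Type} (S : state Var) a :
  good S -> ~ In (a, CTop) (rights S).
Proof.
  intros (_ & L & R & ND & _ & _ & _ & DR) Ha.
  destruct (DR _ _ Ha) as [HR|[]]. destruct (In_Permutation _ _ HR) as (R1 & HP).
  apply ND. refine (derivable_repr _ _ _ (d_topR _ (atoms S) L R1 a) _ _ _ HP);
    auto using incl_refl.
Qed.

Lemma good_not_right_emp {Var : Type} (S : state Var) :
  good S -> ~ In (Le, CEmp) (rights S).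
Proof.
  intros (_ & L & R & ND & _ & _ & _ & DR) Ha.
  destruct (DR _ _ Ha) as [HR|[]]. destruct (In_Permutation _ _ HR) as (R1 & HP).
  apply ND. refine (derivable_repr _ _ _ (d_empR _ (atoms S) L R1) _ _ _ HP);
    auto using incl_refl.
Qed.

(** Propositional variables stay in the residue for good, so a clash is caught even if the two
    occurrences entered at different stages. *)
Lemma good_not_both_sides {Var : Type} (S : state Var) a p :
  good S -> In (a, CVar p) (lefts S) -> ~ In (a, CVar p) (rights S).
Proof.
  intros (_ & L & R & ND & _ & _ & DL & DR) Hl Hr.
  destruct (DL _ _ Hl) as [HL|[]]. destruct (In_Permutation _ _ HL) as (L1 & HP).
  destruct (DR _ _ Hr) as [HR|[]]. destruct (In_Permutation _ _ HR) as (R1 & HP').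
  apply ND. refine (derivable_repr _ _ _ (d_id _ (atoms S) L1 R1 a p) _ _ HP HP'); apply incl_refl.
Qed.

(** * The frame of label classes and the truth lemma *)

Definition lim_world {Var : Type} (f : nat -> state Var) : Type :=
  {P : label -> Prop | exists a, P = lim_eq f a}.

Definition class {Var : Type} (f : nat -> state Var) (a : label) : lim_world f :=
  exist _ (lim_eq f a) (ex_intro _ a eq_refl).

(** The frame conditions speak of equality of worlds, so the quotient consists of the equivalence
    classes themselves, as predicates; extensionality makes classes of equivalent labels equal. *)
Lemma class_eq {Var : Type} (f : nat -> state Var) a b :
  fair f -> class f a = class f b <-> lim_eq f a b.
Proof.
  intros Hf. split.
  - intros E. apply (f_equal (@proj1_sig _ _)) in E. simpl in E. rewrite E.
    now exists 0.
  - intros E. apply eq_sig_hprop; [intros; apply proof_irrelevance|]. simpl.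
    apply functional_extensionality. intros c. apply propositional_extensionality.
    split; intros H; eapply lim_eq_trans; eauto using lim_eq_sym.
Qed.

Lemma class_surj {Var : Type} (f : nat -> state Var) (h : lim_world f) :
  exists a, h = class f a.
Proof. destruct h as [P [a ->]]. now exists a. Qed.

Definition lim_frame {Var : Type} (f : nat -> state Var) : frame :=
  {| world := lim_world f;
     rel := fun h1 h2 h3 => exists a b c,
       h1 = class f a /\ h2 = class f b /\ h3 = class f c /\ lim_rel f a b c;
     eps := class f Le |}.

Lemma lim_frame_rel {Var : Type} (f : nat -> state Var) a b c :
  fair f ->
  @rel (lim_frame f) (class f a) (class f b) (class f c) <-> lim_rel f a b c.
Proof.
  intros Hf. split.
  - intros (a' & b' & c' & Ha & Hb & Hc & Hr).
    apply class_eq in Ha, Hb, Hc; try assumption.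
    revert Hr. apply lim_rel_cong; auto using lim_eq_sym.
  - intros Hr. now exists a, b, c.
Qed.

Lemma lim_frame_partial_monoidal {Var : Type} (f : nat -> state Var) :
  fair f -> partial_monoidal_frame (lim_frame f).
Proof.
  intros Hf. split; [|split; [|split]].
  - intros h1 h2. destruct (class_surj f h1) as [a ->], (class_surj f h2) as [b ->].
    change (eps (lim_frame f)) with (class f Le).
    rewrite lim_frame_rel by assumption.
    transitivity (lim_eq f a b); [split | symmetry; now apply class_eq].
    + intros Hr. now apply lim_unit_eq, lim_comm.
    + intros Hr. apply (lim_rel_cong f a Le a); auto using lim_unit.
      * now exists 0.
      * now exists 0.
  - intros h1 h2 h3.
    destruct (class_surj f h1) as [a ->], (class_surj f h2) as [b ->],
      (class_surj f h3) as [c ->].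
    rewrite !lim_frame_rel by assumption. split; now apply lim_comm.
  - intros h1 h2 h3 h4 h5.
    destruct (class_surj f h1) as [a1 ->], (class_surj f h2) as [a2 ->],
      (class_surj f h3) as [a3 ->], (class_surj f h4) as [a4 ->],
      (class_surj f h5) as [a5 ->].
    rewrite !lim_frame_rel by assumption. intros [H1 H2].
    (* Rule [A] has the shared label in first place where the frame condition has it in second, so
       both atoms are flipped. *)
    destruct (lim_assoc f a5 a1 a4 a3 a2 Hf) as (w & Hw1 & Hw2);
      [now apply lim_comm..|].
    exists (class f w). rewrite !lim_frame_rel by assumption.
    split; [now apply lim_comm | assumption].
  - intros h1 h2 h3 h4.
    destruct (class_surj f h1) as [a1 ->], (class_surj f h2) as [a2 ->],
      (class_surj f h3) as [a3 ->], (class_surj f h4) as [a4 ->].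
    rewrite !lim_frame_rel by assumption. intros [H1 H2].
    apply class_eq; [assumption|]. now apply (lim_functional f a1 a2).
Qed.

(** The least valuation satisfying every propositional variable met on the left. *)
Definition lim_val {Var : Type} (f : nat -> state Var) (p : Var) (h : lim_frame f) : Prop :=
  exists a, h = class f a /\ lim_left f a (CVar p).

(** The two halves need each other, because implications and wands move subformulae across the
    turnstile. Nothing is claimed about formulae met on neither side. *)
Lemma truth {Var : Type} (f : nat -> state Var) (F : core Var) :
  fair f -> forall a,
  (lim_left f a F -> cforces (lim_val f) (class f a : lim_frame f) F) /\
  (lim_right f a F -> ~ cforces (lim_val f) (class f a : lim_frame f) F).
Proof.
  intros Hf.
  induction F as [p| | |A IHA B IHB|A IHA B IHB| |A IHA B IHB|A IHA B IHB];
    intros a; split; intros Ha; simpl; auto.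
  - now exists a.
  (* The valuation yields some label [b] in the class of [a]; the left occurrence is first
     transported to [a], then both are read at one late stage. *)
  - intros (b & E & Hb). apply class_eq in E; [|assumption].
    apply (lim_left_cong f b a) in Hb; [|assumption|now apply lim_eq_sym].
    destruct (lim_left_eventually f _ _ Hf Hb) as (n & i & Hi).
    destruct (lim_right_eventually f _ _ Hf Ha) as (m & j & Hj).
    apply (good_not_both_sides (f (n + m)) (now_ (f (n + m)) a) p (proj1 (Hf _))).
    + apply nth_error_In with i, Hi. lia.
    + apply nth_error_In with j, Hj. lia.
  - destruct Ha as (n & Ha). exfalso.
    exact (good_not_right_top _ _ (proj1 (Hf n)) Ha).
  - destruct Ha as (n & Ha). exact (good_not_left_bot _ _ (proj1 (Hf n)) Ha).
  - destruct (lim_doneL f a _ Hf Ha I) as (n & HA & HB).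
    split; [apply IHA | apply IHB]; now exists n.
  - destruct (lim_doneR f a _ Hf Ha I) as (n & [HA|HB]); intros [FA FB].
    + revert FA. apply IHA. now exists n.
    + revert FB. apply IHB. now exists n.
  - destruct (lim_doneL f a _ Hf Ha I) as (n & [HA|HB]); intros FA.
    + exfalso. revert FA. apply IHA. now exists n.
    + apply IHB. now exists n.
  - destruct (lim_doneR f a _ Hf Ha I) as (n & HA & HB); intros FAB.
    assert (HB' : lim_right f a B) by now exists n.
    apply (proj2 (IHB a) HB'), FAB, IHA. now exists n.
  (* The atom [(Le, a, Le)] put in by [d_empL] makes [Eq_1] or [Eq_2] identify [a] with epsilon,
     unless they agree already. *)
  - destruct (lim_doneL f a _ Hf Ha I) as (n & HA). simpl in HA.
    apply class_eq; [assumption|]. apply lim_unit_eq; [assumption|].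
    exists n. destruct (Hf n) as (((He & _) & _) & _). now rewrite He.
  - intros E. apply class_eq in E; [|assumption].
    (* Were [a] identified with epsilon, the unit would stand on the right at epsilon itself, an
       instance of [d_empR]. *)
    apply (lim_right_cong f a Le) in Ha; [|assumption..].
    destruct Ha as (n & Ha). destruct (Hf n) as (HS & _).
    rewrite (proj1 (proj1 HS)) in Ha. exact (good_not_right_emp _ HS Ha).
  - destruct (lim_doneL f a _ Hf Ha I) as (n & x & y & Hr & HA & HB).
    exists (class f x), (class f y). split; [|split].
    + apply lim_frame_rel; [assumption|]. now exists n.
    + apply IHA. now exists n.
    + apply IHB. now exists n.
  - intros (h1 & h2 & Hr & FA & FB).
    destruct (class_surj f h1) as [x ->], (class_surj f h2) as [y ->].
    apply (lim_frame_rel f) in Hr; [|assumption].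
    destruct (lim_starR f x y a A B Hf Hr Ha) as [H|H].
    + exact (proj2 (IHA x) H FA).
    + exact (proj2 (IHB y) H FB).
  - intros h1 h2 Hr FA.
    destruct (class_surj f h1) as [x ->], (class_surj f h2) as [y ->].
    apply (lim_frame_rel f) in Hr; [|assumption].
    (* The rule for a wand on the left expects its label in second place, hence the commutation. *)
    destruct (lim_wandL f x a y A B Hf (lim_comm f _ _ _ Hf Hr) Ha) as [H|H].
    + exfalso. exact (proj2 (IHA x) H FA).
    + exact (proj1 (IHB y) H).
  - destruct (lim_doneR f a _ Hf Ha I) as (n & x & y & Hr & HA & HB). intros FAB.
    assert (HB' : lim_right f y B) by now exists n.
    apply (proj2 (IHB y) HB'), (FAB (class f x)).
    + apply lim_frame_rel; [assumption|]. apply lim_comm; [assumption|]. now exists n.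
    + apply IHA. now exists n.
Qed.

Definition initial_state {Var : Type} (A : core Var) : state Var :=
  State (fun a => a) 1 [] [] [(Lv 0, A)].

Lemma initial_state_good {Var : Type} (A : core Var) :
  ~ derivable false [] [] [(Lv 0, A)] -> good (initial_state A).
Proof.
  intros ND. split.
  - repeat split; auto. repeat constructor.
  - exists [], [(Lv 0, A)].
    repeat split; simpl; auto using incl_refl.
Qed.

Theorem mainTheorem14 (Var : Type) (F : formula Var) :
  ((exists w : LVar, derivable_at true w F) ->
     valid_over partial_monoidal_frame F) /\
  (valid_over partial_monoidal_frame F ->
     exists w : LVar, derivable_at false w F).
Proof.
  split.
  - intros (w & D) H HF nu h. apply cforces_expand, NNPP. intros Hn.
    (* The root label is a variable, so it can be sent to the arbitrary world [h], while [update]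
       leaves [Le] at [eps H]. *)
    apply (soundness _ _ _ _ D H nu (update (fun _ => eps H) w h) HF eq_refl).
    split; [constructor|]. split; [constructor|]. constructor; [|constructor].
    unfold lforces; cbn [fst snd]. now rewrite update_same.
  - intros HV. exists 0. apply NNPP. intros ND.
    destruct (fair_exists _ (initial_state_good _ ND)) as (f & Ef & Hf).
    assert (Hr : lim_right f (Lv 0) (expand F)).
    { exists 0. rewrite Ef. simpl; auto. }
    apply (proj2 (truth f (expand F) Hf (Lv 0)) Hr).
    apply cforces_expand, HV, lim_frame_partial_monoidal, Hf.
Qed.
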